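(* Let $0<\alpha<1$, $\nu>0$, $T>1$, let $G\subset\mathbb{R}^n$ be a bounded domain with smooth boundary $\partial G$, and put $\Omega=G\times(1,T]$. Let $F$ (on $\overline\Omega$), $\varphi$ (on $\bar G$) and $\psi$ (on $\partial G\times[1,T]$) be continuous. Then the problem $$u_t(x,t)=\nu\,\Delta_x D_t^{1-\alpha}u(x,t)+F(x,t),\quad (x,t)\in\Omega,$$ $$u(x,1)=\varphi(x),\ x\in\bar G,\qquad u(x,t)=\psi(x,t),\ x\in\partial G,\ 1\le t\le T,$$ has at most one solution.
   Context: $\Delta_x=\sum_{j=1}^n\partial^2/\partial x_j^2$, $\overline\Omega=\bar G\times[1,T]$, and $D_t^{1-\alpha}$ is the Hadamard fractional derivative of order $1-\alpha$ in $t$ with base point $1$: $$D_t^{1-\alpha}u(x,t)=t\frac{\partial}{\partial t}I_t^{\alpha}u(x,t),\qquad I_t^{\alpha}u(x,t)=\frac{1}{\Gamma(\alpha)}\int_1^t\left(\log\frac{t}{s}\right)^{\alpha-1}u(x,s)\,\frac{ds}{s}.$$ Solutions are classical: $u\in C(\overline\Omega)$ is real-valued, $u_t$ exists in $\Omega$, $I_t^{\alpha}u(x,\cdot)\in W^1_2([1,T])$ (Sobolev space) for each $x\in G$, $D_t^{1-\alpha}u$ exists in $\Omega$ and is twice continuously differentiable in $x$ there, and the equation holds at every point of $\Omega$. *)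

(* Defs.v *)
From HB Require Import structures.
From mathcomp Require Import all_boot all_order all_algebra.
From mathcomp Require Import all_classical all_reals all_analysis.

Set Implicit Arguments.
Unset Strict Implicit.
Unset Printing Implicit Defensive.

Import Order.TTheory GRing.Theory Num.Theory.
Import numFieldNormedType.Exports.

Local Open Scope classical_set_scope.
Local Open Scope ring_scope.

Definition Gamma (R : realType) (a : R) : R :=
  \int[lebesgue_measure]_(x in `]0, +oo[) (x `^ (a - 1) * expR (- x)).

(* Derivative at t of a function on the set A, the increments being restricted
   to A: two-sided at interior points, one-sided at the ends of an interval. *)
Definition derivable_in (R : realType) (A : set R) (f : R -> R) (t : R) : Prop :=
  cvg ((f s - f t) / (s - t) @[s --> within A t^']).

Definition derive_in (R : realType) (A : set R) (f : R -> R) (t : R) : R :=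
  lim ((f s - f t) / (s - t) @[s --> within A t^']).

(* I^alpha f (t), with base point 1. *)
Definition hadamard_int (R : realType) (alpha : R) (f : R -> R) (t : R) : R :=
  (Gamma alpha)^-1 *
  \int[lebesgue_measure]_(s in `[1, t]) (ln (t / s) `^ (alpha - 1) * f s / s).

(* The derivative of order 1 - alpha (not alpha) of a function on [1, T]. *)
Definition hadamard_D1 (R : realType) (alpha T : R) (f : R -> R) (t : R) : R :=
  t * derive_in `[1, T] (hadamard_int alpha f) t.

Definition L2 (R : realType) (a b : R) (f : R -> R) : Prop :=
  measurable_fun `[a, b] f /\
  lebesgue_measure.-integrable `[a, b] (fun x => (f x ^+ 2)%:E).

Definition test_function (R : realType) (a b : R) (phi : R -> R) : Prop :=
  (forall k x, derivable (phi^`(k))%classic x 1) /\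
  exists c d : R, [/\ a < c, d < b & forall x, x \notin `[c, d] -> phi x = 0].

Definition sobolev12 (R : realType) (a b : R) (f : R -> R) : Prop :=
  L2 a b f /\
  exists2 g : R -> R, L2 a b g &
    forall phi : R -> R, test_function a b phi ->
      \int[lebesgue_measure]_(x in `[a, b]) (f x * (phi^`())%classic x) =
      - \int[lebesgue_measure]_(x in `[a, b]) (g x * phi x).

Section Space.
Variables (R : realType) (n : nat).

Definition unit_vec (i : 'I_n) : 'rV[R]_n := delta_mx 0 i.

Definition partial (i : 'I_n) (f : 'rV[R]_n -> R) : 'rV[R]_n -> R :=
  fun x => 'D_(unit_vec i) f x.

Definition laplacian (f : 'rV[R]_n -> R) (x : 'rV[R]_n) : R :=
  \sum_(i < n) partial i (partial i f) x.

Definition smooth_on (U : set 'rV[R]_n) (f : 'rV[R]_n -> R) : Prop :=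
  forall (s : seq 'I_n) (x : 'rV[R]_n), U x ->
    {for x, continuous (foldr partial f s)} /\
    forall i, derivable (foldr partial f s) x (unit_vec i).

Definition boundary (G : set 'rV[R]_n) : set 'rV[R]_n := closure G `\` G°.

(* Near each boundary point, G is the negativity set of a smooth function
   with nonvanishing gradient; G thus lies on one side of its boundary. *)
Definition smooth_boundary (G : set 'rV[R]_n) : Prop :=
  forall p, boundary G p ->
    exists (U : set 'rV[R]_n) (rho : 'rV[R]_n -> R),
      [/\ open U, U p, smooth_on U rho,
          forall x, U x -> exists i, partial i rho x != 0 &
          G `&` U = [set x | U x /\ rho x < 0]].

Definition domain (G : set 'rV[R]_n) : Prop :=
  [/\ open G, connected G & G !=set0].

(* All derivatives in x of orders 1 and 2 of w exist in D and are continuous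
   on D as functions of (x, t). *)
Definition C2_in_x (D : set ('rV[R]_n * R)) (w : 'rV[R]_n -> R -> R) : Prop :=
  (forall i, (forall x t, D (x, t) -> derivable (w ^~ t) x (unit_vec i)) /\
     {within D, continuous (fun p => partial i (w ^~ p.2) p.1)}) /\
  (forall i j,
     (forall x t, D (x, t) -> derivable (partial i (w ^~ t)) x (unit_vec j)) /\
     {within D, continuous (fun p => partial j (partial i (w ^~ p.2)) p.1)}).

Definition Omega (G : set 'rV[R]_n) (T : R) : set ('rV[R]_n * R) :=
  G `*` `]1, T].

Definition Omega_bar (G : set 'rV[R]_n) (T : R) : set ('rV[R]_n * R) :=
  closure G `*` `[1, T].

(* Only the values of u on Omega_bar G T matter. *)
Record classical_solution (alpha nu T : R) (G : set 'rV[R]_n)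
    (F : 'rV[R]_n -> R -> R) (phi : 'rV[R]_n -> R) (psi : 'rV[R]_n -> R -> R)
    (u : 'rV[R]_n -> R -> R) : Prop := {
  sol_continuous : {within Omega_bar G T, continuous (fun p => u p.1 p.2)};
  sol_derivable : forall x t, Omega G T (x, t) ->
    derivable_in `[1, T] (u x) t;
  sol_sobolev : forall x, G x -> sobolev12 1 T (hadamard_int alpha (u x));
  sol_hadamard : forall x t, Omega G T (x, t) ->
    derivable_in `[1, T] (hadamard_int alpha (u x)) t;
  sol_C2 : C2_in_x (Omega G T) (fun x t => hadamard_D1 alpha T (u x) t);
  sol_equation : forall x t, Omega G T (x, t) ->
    derive_in `[1, T] (u x) t =
    nu * laplacian (fun y => hadamard_D1 alpha T (u y) t) x + F x t;
  sol_initial : forall x, closure G x -> u x 1 = phi x;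
  sol_boundary : forall x t, boundary G x -> t \in `[1, T] -> u x t = psi x t
}.

End Space.

(* Main.v *)
Require Import Defs.
From HB Require Import structures.
From mathcomp Require Import all_boot all_order all_algebra.
From mathcomp Require Import all_classical all_reals all_analysis.
From mathcomp Require Import measurable_realfun.
From mathcomp Require Import ring lra.

Set Implicit Arguments.
Unset Strict Implicit.
Unset Printing Implicit Defensive.

Import Order.TTheory GRing.Theory Num.Theory.
Import numFieldNormedType.Exports.

Local Open Scope classical_set_scope.
Local Open Scope ring_scope.

(** Let w = u - v, and let g be the Hadamard integral of w of order alpha. Then
    w has zero initial and boundary values and w_t = nu Lap z with z = t g_t.
    The equation gives no sign to w at its own extrema, since the Laplacian acts
    on z, and z is controlled neither near the boundary of G nor near t = 1. The
    function g, however, is continuous on the closed cylinder and vanishes for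
    t = 1 and on the boundary; and w_t / t = nu Lap g_t, so that formally

      L(x, t) := w / t + (integral of w / s^2 over 1 <= s <= t) = nu Lap g.

    The theorem follows from two opposite statements about the sign of L at a
    positive maximum of g.

    In space: if g(., t) is maximal at x, then L(x, t) <= 0
    ([maximum_weighted_le0]). As g need not have second derivatives, the proof
    works with second differences in x: the time derivative of a second
    difference of g is a second derivative of z at a nearby point, divided by t,
    hence close to L_t / nu, uniformly for t in [t1, T] with t1 > 1
    ([weighted_growth]). Letting t1 tend to 1 requires maximum points of
    g(., t) - g(., t1) that converge to x, which a quadratic penalty provides.

    In time: if f = w(x, .) vanishes on [1, tau], if |g| is maximal over [1, t0]
    at t0, where g = M > 0, and if t0 / tau is close to 1, then L(x, t0) > 0
    ([hadamard_volterra_gt0]). Indeed integrating g with order 1 - alpha gives,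
    up to a constant, the plain integral F of f ds / s ([hadamard_comp]). With
    l = log (t0 / tau), the monotonicity of the kernel bounds f(t0) below by a
    multiple of M l^(- alpha) ([hadamard_extremum]), while F is at most a
    multiple of M l^(1 - alpha) ([hadamard1_bound]); for small l the former
    dominates the contributions of F to L.

    So once w vanishes up to time tau, the function g vanishes up to time
    (1 + (1 - alpha) / 8) tau; there z = 0, w_t = 0 and w = 0 as well
    ([slab_vanish]). Finitely many such slabs reach T. *)

(** * Integrals of functions that blow up at the ends of an interval *)

Section OpenInterval.
Context {R : realType}.
Implicit Types (f F G : R -> R) (a b : R).
Local Notation mu := (@lebesgue_measure R).

Lemma cvg_near_eq (T : Type) (A : set_system T) {FA : Filter A} (f g : T -> R)
    (l : R) :
  (\forall x \near A, f x = g x) -> f @ A --> l -> g @ A --> l.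
Proof.
move=> fg fl; apply: (cvg_trans _ fl); apply: near_eq_cvg.
exact: fg.
Qed.

(** The integrands below are singular at the ends of the interval, whereas the
    fundamental theorem of calculus and the change of variables are available
    for continuous functions on closed intervals; this monotone limit connects
    the two. *)
Lemma cvg_integral_exhaustion f a b (u v : R^nat) :
  {in `]a, b[, forall x, 0 <= f x} -> {in `]a, b[, continuous f} ->
  nonincreasing_seq u -> nondecreasing_seq v ->
  (forall n, a < u n) -> (forall n, v n < b) ->
  u @ \oo --> a -> v @ \oo --> b ->
  (\int[mu]_(x in `[u n, v n]) (f x)%:E @[n --> \oo] -->
   \int[mu]_(x in `]a, b[) (f x)%:E)%E.
Proof.
move=> f0 cf ndu ndv au vb cu cv.
have sub n : `[u n, v n] `<=` `]a, b[.
  by move=> x /=; rewrite !in_itv/= => /andP[ux xv];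
    rewrite (lt_le_trans (au n) ux) (le_lt_trans xv (vb n)).
have mf : measurable_fun `]a, b[ f.
  apply: open_continuous_measurable_fun; first exact: interval_open.
  by move=> x; rewrite inE => /= xab; exact: cf.
have E : `]a, b[%classic = \bigcup_n `[u n, v n]%classic.
  apply/seteqP; split => [x /=|x [n _]]; last exact: sub.
  rewrite in_itv/= => /andP[ax xb].
  have [n [un vn]] : exists n, u n < x /\ x < v n.
    near \oo => n; exists n; split; near: n.
      exact: (cvgr_lt a).
    exact: (cvgr_gt b).
  by exists n => //=; rewrite in_itv/= !ltW.
rewrite E; apply: ge0_nondecreasing_set_cvg_integral.
- apply/nondecreasing_seqP => n; rewrite subsetEset => x /=.
  rewrite !in_itv/= => /andP[ux xv].
  by rewrite (le_trans _ ux) ?ndu// (le_trans xv)// ndv.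
- by [].
- move=> n; apply/measurable_EFinP; apply: measurable_funS mf => //.
- by move=> n x /sub /f0; rewrite lee_fin.
Unshelve. all: by end_near. Qed.

Lemma exists_exhaustion a b : a < b -> exists u v : R^nat,
  [/\ nonincreasing_seq u, nondecreasing_seq v,
    (forall n, a < u n /\ v n < b), (forall n, u n < v n) &
    u @ \oo --> a /\ v @ \oo --> b].
Proof.
move=> ab; pose d (n : nat) : R := (b - a) / 3 * n.+1%:R^-1.
have ba : 0 < (b - a) / 3 by lra.
have dn : nonincreasing_seq d.
  apply/nonincreasing_seqP => n; rewrite ler_pM2l// lef_pV2 ?posrE//.
  by rewrite ler_nat.
have d0 n : 0 < d n by rewrite mulr_gt0.
have d1 n : d n <= (b - a) / 3.
  by rewrite ger_pMr// invf_le1// ler1n.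
have cd : d @ \oo --> 0.
  rewrite -[X in _ --> X](mulr0 ((b - a) / 3)).
  by apply: cvgMr; exact: cvg_harmonic.
exists (fun n => a + d n), (fun n => b - d n); split.
- by move=> n m nm; rewrite lerD2l; exact: dn.
- by move=> n m nm; rewrite lerD2l lerN2; exact: dn.
- by move=> n; have := d0 n; split; lra.
- by move=> n; have := d1 n; lra.
- split.
    by rewrite -[X in _ --> X]addr0; apply: cvgD => //; exact: cvg_cst.
  by rewrite -[X in _ --> X]subr0; apply: cvgB => //; exact: cvg_cst.
Qed.

Lemma within_itv_cvg_exhaustion F a b (u v : R^nat) : a < b ->
  {within `[a, b], continuous F} ->
  (forall n, a < u n /\ v n < b) -> u @ \oo --> a /\ v @ \oo --> b ->
  F (u n) @[n --> \oo] --> F a /\ F (v n) @[n --> \oo] --> F b.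
Proof.
move=> ab /(continuous_within_itvP _ ab)[_ Fa Fb] abuv [cu cv]; split.
  by move/cvg_at_rightP : Fa; apply; split => // n; case: (abuv n).
by move/cvg_at_leftP : Fb; apply; split => // n; case: (abuv n).
Qed.

Lemma is_derive_continuous F (x d : R) :
  is_derive x 1 F d -> {for x, continuous F}.
Proof.
by move=> dF; apply/differentiable_continuous/derivable1_diffP; exact: ex_derive.
Qed.

Lemma derivable_oo_sub F f a b c d : a < c -> c < d -> d < b ->
  (forall x, x \in `]a, b[ -> is_derive x 1 F (f x)) ->
  derivable_oo_LRcontinuous F c d.
Proof.
move=> ac cd db dF.
have dF' x : a < x -> x < b -> is_derive x 1 F (f x).
  by move=> ax xb; apply: dF; rewrite in_itv/= ax.
split.
- move=> x; rewrite in_itv/= => /andP[cx xd].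
  by have [] : is_derive x 1 F (f x) by apply: dF'; lra.
- apply: cvg_at_right_filter; apply: (@is_derive_continuous _ _ (f c)).
  by apply: dF' => //; lra.
- apply: cvg_at_left_filter; apply: (@is_derive_continuous _ _ (f d)).
  by apply: dF' => //; lra.
Qed.

(** The antiderivative stays continuous up to the ends although [f] may not. *)
Lemma ge0_integral_derivative_oo f F a b : a < b ->
  {in `]a, b[, forall x, 0 <= f x} -> {in `]a, b[, continuous f} ->
  {within `[a, b], continuous F} ->
  (forall x, x \in `]a, b[ -> is_derive x 1 F (f x)) ->
  (\int[mu]_(x in `]a, b[) (f x)%:E = (F b - F a)%:E)%E.
Proof.
move=> ab f0 cf cF dF.
have [u [v [ndu ndv abuv uv cuv]]] := exists_exhaustion ab.
have [Fu Fv] := within_itv_cvg_exhaustion ab cF abuv cuv.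
have sub n x : x \in `[u n, v n] -> x \in `]a, b[.
  rewrite !in_itv/= => /andP[ux xv]; have [? ?] := abuv n.
  by rewrite (lt_le_trans _ ux) ?(le_lt_trans xv).
have H := cvg_integral_exhaustion f0 cf ndu ndv (fun n => (abuv n).1)
  (fun n => (abuv n).2) cuv.1 cuv.2.
rewrite -(cvg_lim _ H)//; apply/cvg_lim => //.
have -> : (fun n => \int[mu]_(x in `[u n, v n]) (f x)%:E)%E =
    (fun n => (F (v n) - F (u n))%:E).
  apply/funext => n; rewrite EFinB; apply: continuous_FTC2 => //.
  - apply: continuous_in_subspaceT => x; rewrite inE/= => /sub; exact: cf.
  - exact: (derivable_oo_sub (abuv n).1 (uv n) (abuv n).2 dF).
  - move=> x xuv; rewrite derive1E; apply: derive_val; apply: dF; apply: (sub n).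
    by move: xuv; rewrite !in_itv/= => /andP[/ltW -> /ltW ->].
by apply: cvg_EFin; [exact: nearW|exact: cvgB].
Qed.

Lemma ge0_integration_by_substitution_oo F dF G a b : a < b ->
  {in `[a, b] &, {homo F : x y / x < y}} ->
  {within `[a, b], continuous F} ->
  (forall x, x \in `]a, b[ -> is_derive x 1 F (dF x)) ->
  {in `]a, b[, continuous dF} -> {in `]a, b[, forall x, 0 <= dF x} ->
  {in `]F a, F b[, forall x, 0 <= G x} -> {in `]F a, F b[, continuous G} ->
  (\int[mu]_(x in `]F a, F b[) (G x)%:E =
   \int[mu]_(x in `]a, b[) (G (F x) * dF x)%:E)%E.
Proof.
move=> ab incF cF F'dF cdF dF0 G0 cG.
have [u [v [ndu ndv abuv uv cuv]]] := exists_exhaustion ab.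
have [Fu Fv] := within_itv_cvg_exhaustion ab cF abuv cuv.
have subcc n x : x \in `[u n, v n] -> x \in `]a, b[.
  rewrite !in_itv/= => /andP[ux xv]; have [? ?] := abuv n.
  by rewrite (lt_le_trans _ ux) ?(le_lt_trans xv).
have inu n : u n \in `]a, b[ by apply: (subcc n); rewrite in_itv/= lexx ltW.
have inv n : v n \in `]a, b[.
  by apply: (subcc n); rewrite in_itv/= lexx andbT ltW.
have sub x : x \in `]a, b[ -> x \in `[a, b].
  by rewrite !in_itv/= => /andP[/ltW -> /ltW ->].
have ina : a \in `[a, b] by rewrite in_itv/= lexx ltW.
have inb : b \in `[a, b] by rewrite in_itv/= lexx andbT ltW.
have lF x y : x \in `[a, b] -> y \in `[a, b] -> x <= y -> F x <= F y.
  move=> xab yab; rewrite le_eqVlt => /predU1P[->//|xy].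
  by rewrite ltW// incF.
have aFb x : x \in `]a, b[ -> F x \in `]F a, F b[.
  move=> xab; have := xab; rewrite !in_itv/= => /andP[ax xb].
  by rewrite !incF// sub.
have F'E x : x \in `]a, b[ -> (F^`() x)%classic = dF x.
  by move=> /F'dF xdF; rewrite derive1E derive_val.
have cF' : {in `]a, b[, continuous (F^`())%classic}.
  move=> x xab; have nF : \forall y \near x, dF y = (F^`() y)%classic.
    have : \forall y \near x, y \in `]a, b[ by exact: near_in_itvoo.
    by apply: filterS => y /F'E.
  rewrite /prop_for /continuous_at F'E//.
  by apply: cvg_trans (cdF _ xab); apply: near_eq_cvg.
have contF : {in `]a, b[, continuous F}.
  by move=> x /F'dF; exact: is_derive_continuous.
have H1 := @cvg_integral_exhaustion G (F a) (F b) (F \o u) (F \o v) G0 cG.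
have H2 := @cvg_integral_exhaustion (fun x => G (F x) * dF x) a b u v.
have <- : (lim (\int[mu]_(x in `[F (u n), F (v n)]) (G x)%:E @[n --> \oo]) =
  \int[mu]_(x in `]F a, F b[) (G x)%:E)%E.
  apply/cvg_lim => //; apply: H1 => //.
  - by move=> n m nm; apply: lF; [exact/sub|exact/sub|exact/ndu].
  - by move=> n m nm; apply: lF; [exact/sub|exact/sub|exact/ndv].
  - by move=> n; have := aFb _ (inu n); rewrite in_itv/= => /andP[].
  - by move=> n; have := aFb _ (inv n); rewrite in_itv/= => /andP[].
have <- : (lim (\int[mu]_(x in `[u n, v n]) (G (F x) * dF x)%:E
    @[n --> \oo]) = \int[mu]_(x in `]a, b[) (G (F x) * dF x)%:E)%E.
  apply/cvg_lim => //; apply: H2 => //.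
  - by move=> x xab; rewrite mulr_ge0// ?dF0// G0// aFb.
  - move=> x xab; apply: continuousM; last exact: cdF.
    by apply: continuous_comp; [exact: contF|apply/cG/aFb].
  - by move=> n; case: (abuv n).
  - by move=> n; case: (abuv n).
  - by case: cuv.
  - by case: cuv.
congr (lim (_ @ \oo)); apply/funext => n.
have uvsub x : x \in `](u n), (v n)[ -> x \in `]a, b[.
  by rewrite !in_itv/= => /andP[ux xv]; have [? ?] := abuv n;
    rewrite (lt_trans _ ux) ?(lt_trans xv).
rewrite integration_by_substitution_increasing.
- apply: eq_integral => x; rewrite inE/= => /subcc xab.
  by congr (_%:E); rewrite -(F'E _ xab).
- exact/ltW.
- by move=> x y /subcc/sub xab /subcc/sub yab; exact: incF.
- by move=> x /uvsub; exact: cF'.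
- apply/cvg_ex; exists (F^`() (u n))%classic; apply: cvg_at_right_filter.
  exact: cF'.
- apply/cvg_ex; exists (F^`() (v n))%classic; apply: cvg_at_left_filter.
  exact: cF'.
- exact: (derivable_oo_sub (abuv n).1 (uv n) (abuv n).2 F'dF).
- apply: continuous_in_subspaceT => x; rewrite inE/= => xF; apply: cG.
  move: xF; rewrite !in_itv/= => /andP[ux xv].
  have := aFb _ (inu n); have := aFb _ (inv n); rewrite !in_itv/=.
  by move=> /andP[_ ?] /andP[? _]; rewrite (lt_le_trans _ ux) ?(le_lt_trans xv).
Qed.

End OpenInterval.

(** * The logarithmic kernel *)

Section HadamardKernel.
Context {R : realType}.
Implicit Types (f g : R -> R) (a b s t tau sigma C : R).
Local Notation mu := (@lebesgue_measure R).

(** The Hadamard kernel of order [b] together with the density [1 / s] of the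
    measure [ds / s], and without the factor [1 / Gamma b]. *)
Definition hkernel b t s := ln (t / s) `^ (b - 1) / s.

Lemma hkernel_ge0 b t s : 0 <= s -> 0 <= hkernel b t s.
Proof. by move=> s0; rewrite divr_ge0// powR_ge0. Qed.

Lemma measurable_invr : measurable_fun [set: R] (@GRing.inv R).
Proof.
(* powers with a real exponent are measurable, but agree with the inverse
   only for a nonnegative base *)
have -> : @GRing.inv R = (fun x : R => x * (x ^+ 2) `^ (-1)).
  apply/funext => x; rewrite powR_inv1 ?sqr_ge0//.
  have [->|x0] := eqVneq x 0; first by rewrite mul0r invr0.
  by field.
apply: measurable_funM => //.
exact: (measurableT_comp (measurable_powR _) (exprn_measurable 2)).
Qed.

Lemma measurable_hkernel b :
  measurable_fun [set: R * R] (fun p : R * R => hkernel b p.1 p.2).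
Proof.
have m1 : measurable_fun [set: R * R] (fun p : R * R => p.2^-1).
  exact: (measurableT_comp measurable_invr measurable_snd).
apply: measurable_funM => //.
apply: (measurableT_comp (measurable_powR _)).
apply: (measurableT_comp (@measurable_ln R)).
exact: measurable_funM.
Qed.

Lemma measurable_hkernelr b t : measurable_fun [set: R] (hkernel b t).
Proof.
exact: (measurableT_comp (measurable_hkernel b) (measurable_pair1 t)).
Qed.

Lemma div_gt1 s t : 0 < s -> s < t -> 1 < t / s.
Proof. by move=> s0 st; rewrite ltr_pdivlMr// mul1r. Qed.

Lemma continuous_ln_div s t : 0 < s -> s < t ->
  {for s, continuous (fun s => ln (t / s))}.
Proof.
move=> s0 st; have ts0 : 0 < t / s by rewrite divr_gt0// (lt_trans s0).
apply: continuous_comp; last exact: continuous_ln.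
apply: continuousM; first exact: cst_continuous.
by apply: continuousV; [exact: lt0r_neq0|exact: cvg_id].
Qed.

Lemma is_derive_ln_div s t : 0 < s -> s < t ->
  is_derive s 1 (fun s => ln (t / s)) (- s^-1).
Proof.
move=> s0 st; have ts0 : 0 < t / s by rewrite divr_gt0// (lt_trans s0).
have Hln := is_derive1_ln ts0.
have dV : is_derive s 1 (fun y : R => y^-1) (- s ^- 2 *: 1).
  by apply: is_deriveV; exact: lt0r_neq0.
have dM : is_derive s 1 (fun y : R => t / y) (t *: (- s ^- 2 *: 1)).
  exact: is_deriveZ.
have H := @is_derive1_comp _ (@ln R) (fun y => t / y) s _ _ Hln dM.
have -> : - s^-1 = (t / s)^-1 * (t *: (- s ^- 2 *: 1)).
  by rewrite /GRing.scale/= mulr1; field; rewrite !lt0r_neq0// (lt_trans s0).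
exact: H.
Qed.

Lemma continuous_powR_gt0 (x p : R) : 0 < x -> {for x, continuous (@powR R ^~ p)}.
Proof.
move=> x0; apply/differentiable_continuous/derivable1_diffP.
by apply: derivable_powR; rewrite in_itv/= x0.
Qed.

Lemma continuous_hkernel b s t : 0 < s -> s < t ->
  {for s, continuous (hkernel b t)}.
Proof.
move=> s0 st; apply: continuousM; last first.
  by apply: continuousV; [exact: lt0r_neq0|exact: cvg_id].
apply: (@continuous_comp _ _ _ (fun s => ln (t / s)) (@powR R ^~ (b - 1))).
  exact: continuous_ln_div.
by apply: continuous_powR_gt0; rewrite ln_gt0// div_gt1.
Qed.

Lemma is_derive_powR_ln_div b s t : 0 < b -> 0 < s -> s < t ->
  is_derive s 1 (fun s => - (ln (t / s) `^ b / b)) (hkernel b t s).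
Proof.
move=> b0 s0 st.
have l0 : 0 < ln (t / s) by rewrite ln_gt0// div_gt1.
have H := @is_derive1_comp _ (@powR R ^~ b) (fun s => ln (t / s)) s _ _
  (is_derive1_powR b l0) (is_derive_ln_div s0 st).
have -> : (fun s => - (ln (t / s) `^ b / b)) =
    - b^-1 \*: (@powR R ^~ b \o (fun s => ln (t / s))).
  by apply/funext => r /=; rewrite /GRing.scale/= mulNr mulrC.
have -> : hkernel b t s = - b^-1 *: (b * ln (t / s) `^ (b - 1) * - s^-1).
  by rewrite /hkernel /GRing.scale/=; field; rewrite !lt0r_neq0.
exact: is_deriveZ.
Qed.

(** The antiderivative of the kernel is continuous up to the diagonal because
    [b > 0], although the kernel itself is infinite there when [b < 1]. *)
Lemma continuous_powR_ln_div b tau t : 0 < b -> 0 < tau -> tau < t ->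
  {within `[tau, t], continuous (fun s => - (ln (t / s) `^ b / b))}.
Proof.
move=> b0 tau0 taut; have t0 : 0 < t := lt_trans tau0 taut.
have cin s : 0 < s -> s < t ->
    {for s, continuous (fun s => - (ln (t / s) `^ b / b))}.
  by move=> s0 st; apply: is_derive_continuous; exact: is_derive_powR_ln_div.
apply/(continuous_within_itvP _ taut); split.
- by move=> s; rewrite in_itv/= => /andP[taus st]; apply: cin => //; lra.
- by apply: cvg_at_right_filter; exact: cin.
- rewrite divff ?lt0r_neq0// ln1 powR0 ?lt0r_neq0// mul0r oppr0.
  rewrite -[X in _ --> X]oppr0; apply: cvgN; rewrite -[X in _ --> X](mul0r b^-1).
  apply: cvgMl; apply/cvg_at_leftP => u [ut cu].
  have un0 : \forall n \near \oo, 0 < u n by exact: (cvgr_gt t).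
  (* ln (t / u n), made positive for the finitely many n with u n <= 0 *)
  pose v n := if 0 < u n then ln (t / u n) else 1.
  have vu : \forall n \near \oo, v n = ln (t / u n).
    by apply: filterS un0 => n; rewrite /v => ->.
  have cv : v @ \oo --> 0.
    have cd : t / u n @[n --> \oo] --> t / t.
      by apply: cvgM; [exact: cvg_cst|apply: cvgV; rewrite ?lt0r_neq0].
    have cl : {for t / t, continuous (@ln R)}.
      by apply: continuous_ln; rewrite divff// lt0r_neq0.
    have := continuous_cvg _ cl cd; rewrite divff ?lt0r_neq0// ln1.
    by move=> /(_ _); apply: cvg_near_eq; apply: filterS vu => n ->.
  have v0 n : 0 < v n.
    by rewrite /v; case: ifPn => // u0; rewrite ln_gt0// div_gt1.
  have /cvg_at_rightP := powR_cvg0 b0.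
  move=> /(_ v (conj v0 cv)); apply: cvg_near_eq.
  by apply: filterS vu => n ->.
Qed.

Lemma integral_hkernel b tau t : 0 < b -> 0 < tau -> tau <= t ->
  (\int[mu]_(s in `[tau, t]) (hkernel b t s)%:E =
   (ln (t / tau) `^ b / b)%:E)%E.
Proof.
move=> b0 tau0; rewrite le_eqVlt => /predU1P[->|taut].
  have [t0|t0] := eqVneq t 0.
    by rewrite t0 invr0 mulr0 ln0// powR0 ?lt0r_neq0// mul0r set_itv1 integral_set1.
  by rewrite set_itv1 integral_set1 divff// ln1 powR0 ?lt0r_neq0// mul0r.
have t0 : 0 < t := lt_trans tau0 taut.
rewrite (integral_itv_bndoo true false); last first.
  by apply/measurable_EFinP/measurable_funTS; exact: measurable_hkernelr.
have k0 : {in `]tau, t[, forall s, 0 <= hkernel b t s}.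
  by move=> s; rewrite in_itv/= => /andP[ts _]; rewrite hkernel_ge0//; lra.
have ck : {in `]tau, t[, continuous (hkernel b t)}.
  move=> s; rewrite in_itv/= => /andP[ts ?]; apply: continuous_hkernel => //.
  by lra.
have dk s : s \in `]tau, t[ ->
    is_derive s 1 (fun s => - (ln (t / s) `^ b / b)) (hkernel b t s).
  rewrite in_itv/= => /andP[ts ?]; apply: is_derive_powR_ln_div => //.
  by lra.
have -> := ge0_integral_derivative_oo taut k0 ck
  (continuous_powR_ln_div b0 tau0 taut) dk.
rewrite divff ?lt0r_neq0// ln1 powR0 ?lt0r_neq0// mul0r oppr0 sub0r.
by rewrite opprK.
Qed.

End HadamardKernel.

(** * Composition of the kernels of orders a and 1 - a *)

Section HadamardSemigroup.
Context {R : realType}.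
Implicit Types (f g : R -> R) (a b s t tau sigma C : R).
Local Notation mu := (@lebesgue_measure R).

(** Euler's integral B(a, 1 - a). *)
Definition beta_integral a : \bar R :=
  (\int[mu]_(r in `]0%R, 1%R[) ((1 - r) `^ (1 - a - 1) * r `^ (a - 1))%:E)%E.

(** The substitution [s = sigma * (t / sigma) ^ r], that is, [log s] affine in
    [r], turns the logarithms into multiples of [1 - r] and [r]; the powers of
    [log (t / sigma)] cancel, so that the integral does not depend on the
    interval. *)
Lemma integral_hkernel_beta a sigma t : 0 < sigma -> sigma < t ->
  (\int[mu]_(s in `]sigma, t[)
     (hkernel (1 - a) t s * ln (s / sigma) `^ (a - 1))%:E =
   beta_integral a)%E.
Proof.
move=> sg0 sgt; have t0 : 0 < t := lt_trans sg0 sgt.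
pose L := ln (t / sigma); have L0 : 0 < L by rewrite ln_gt0// div_gt1.
pose F r := sigma * expR (r * L).
have F0 : F 0 = sigma by rewrite /F mul0r expR0 mulr1.
have F1 : F 1 = t.
  by rewrite /F mul1r /L lnK ?posrE ?divr_gt0// mulrC divfK// lt0r_neq0.
have Fpos r : 0 < F r by rewrite mulr_gt0// expR_gt0.
have dF (r : R) : is_derive r 1 F (F r * L).
  have H0 : is_derive r 1 (fun r => r * L) L.
    have -> : (fun r => r * L) = L \*: id.
      by apply/funext => x /=; rewrite /GRing.scale/= mulrC.
    by rewrite -[X in is_derive _ _ _ X]mulr1; exact: is_deriveZ.
  have H := @is_derive1_comp _ (@expR R) (fun r => r * L) r _ _
    (is_derive_expR (r * L)) H0.
  rewrite /F -mulrA; exact: (is_deriveZ _ H).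
have cF r : {for r, continuous F} by exact: is_derive_continuous (dF r).
have incF x y : x < y -> F x < F y.
  by move=> xy; rewrite ltr_pM2l// ltr_expR ltr_pM2r.
pose G s := hkernel (1 - a) t s * ln (s / sigma) `^ (a - 1).
have G0 : {in `](F 0), (F 1)[, forall s, 0 <= G s}.
  move=> s; rewrite F0 in_itv/= => /andP[ss _].
  by rewrite mulr_ge0 ?powR_ge0// hkernel_ge0// ltW// (lt_trans sg0).
have cG : {in `](F 0), (F 1)[, continuous G}.
  move=> s; rewrite F0 F1 in_itv/= => /andP[ss st].
  have s0 := lt_trans sg0 ss.
  apply: continuousM; first exact: continuous_hkernel.
  apply: (@continuous_comp _ _ _ (fun s => ln (s / sigma)) (@powR R ^~ (a - 1))).
    apply: (@continuous_comp _ _ _ (fun s => s / sigma) (@ln R)).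
      by apply: continuousM; [exact: cvg_id|exact: cst_continuous].
    by apply: continuous_ln; rewrite divr_gt0.
  by apply: continuous_powR_gt0; rewrite ln_gt0// div_gt1.
have := @ge0_integration_by_substitution_oo R F (fun r => F r * L) G 0 1 ltr01
  (in2W incF) (continuous_subspaceT cF) (fun r _ => dF r).
move=> /(_ _ _ G0 cG); rewrite F0 F1 /G => ->.
- apply: eq_integral => r; rewrite inE/= in_itv/= => /andP[r0 r1].
  congr (_%:E); rewrite /hkernel.
  have -> : t / F r = expR ((1 - r) * L).
    rewrite /F mulrBl mul1r expRD expRN {1}/L lnK ?posrE ?divr_gt0//.
    by field; rewrite !lt0r_neq0// expR_gt0.
  have -> : F r / sigma = expR (r * L).
    by rewrite /F mulrAC divff ?mul1r// lt0r_neq0.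
  rewrite !expRK !powRM ?(ltW L0) ?subr_ge0 ?(ltW r0) ?(ltW r1)//.
  have H : L `^ (1 - a - 1) * L `^ (a - 1) * L = 1.
    rewrite -powRD; last by rewrite lt0r_neq0// implybT.
    have -> : 1 - a - 1 + (a - 1) = -1 by ring.
    by rewrite powR_inv1 ?ltW// mulVf// lt0r_neq0.
  rewrite -[RHS]mulr1 -[X in _ = _ * X]H.
  by move: (F r) (Fpos r) => y y0; field; rewrite lt0r_neq0.
- move=> r _; apply: continuousM; [exact: cF|exact: cst_continuous].
- by move=> r _; rewrite mulr_ge0 ?ltW.
Qed.

(** Both exponents are negative, so that the integrand is at least 1. *)
Lemma beta_integral_ge1 a : 0 < a -> a < 1 -> (1 <= beta_integral a)%E.
Proof.
move=> a0 a1; have -> : (1 = \int[mu]_(r in `]0%R, 1%R[%classic) (cst 1%:E r))%E.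
  by rewrite integral_cst//= lebesgue_measure_itv/= lte_fin ltr01 oppr0 adde0 mul1e.
apply: ge0_le_integral => //.
- apply/measurable_EFinP; apply: measurable_funTS; apply: measurable_funM.
    apply: (measurableT_comp (measurable_powR _)); exact: measurable_funB.
  exact: measurable_powR.
- move=> r /=; rewrite in_itv/= => /andP[r0 r1]; rewrite lee_fin.
  rewrite -[X in X <= _]mulr1 ler_pM//.
  + by rewrite -[X in X <= _](powRr0 (1 - r)) ger_powR//; [apply/andP; split|]; lra.
  + by rewrite -[X in X <= _](powRr0 r) ger_powR//; [apply/andP; split|]; lra.
Qed.

(** Tonelli's theorem on the triangle [1 < r < s < t], the inner integral in [s]
    being the constant of [integral_hkernel_beta]. *)
Lemma ge0_hkernel_tonelli a f t : measurable_fun [set: R] f ->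
  (forall s, 0 <= f s) ->
  (\int[mu]_(s in `]1%R, t[) ((hkernel (1 - a) t s)%:E *
      \int[mu]_(r in `]1%R, s[) (hkernel a s r * f r)%:E) =
   beta_integral a * \int[mu]_(r in `]1%R, t[) (f r / r)%:E)%E.
Proof.
move=> mf f0.
pose K (p : R * R) : \bar R :=
  if [&& 1 < p.2, p.2 < p.1 & p.1 < t]
  then (hkernel (1 - a) t p.1 * (hkernel a p.1 p.2 * f p.2))%:E else 0%E.
have K0 p : (0 <= K p)%E.
  rewrite /K; case: ifPn => // /and3P[p1 p12 _].
  have p2 : 0 <= p.2 by lra.
  have p0 : 0 <= p.1 by lra.
  rewrite lee_fin; apply: mulr_ge0; first exact: hkernel_ge0.
  by apply: mulr_ge0 => //; exact: hkernel_ge0.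
have mK : measurable_fun [set: R * R] K.
  apply: measurable_fun_ifT.
  - apply: measurable_and; first exact: measurable_fun_ltr.
    by apply: measurable_and; exact: measurable_fun_ltr.
  - apply/measurable_EFinP; apply: measurable_funM.
      exact: (measurableT_comp (measurable_hkernelr _ _) measurable_fst).
    apply: measurable_funM; first exact: measurable_hkernel.
    exact: (measurableT_comp mf measurable_snd).
  - exact: measurable_cst.
transitivity (\int[mu]_s \int[mu]_r K (s, r))%E.
  rewrite integral_mkcond; apply: eq_integral => s _; rewrite patchE.
  case: ifPn => [|st].
    rewrite inE/= in_itv/= => /andP[s1 st].
    rewrite -ge0_integralZl//; last 3 first.
    - apply/measurable_EFinP/measurable_funTS/measurable_funM => //.
      exact: measurable_hkernelr.
    - move=> r /=; rewrite in_itv/= => /andP[r1 _].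
      by rewrite lee_fin mulr_ge0// hkernel_ge0//; lra.
    - by rewrite lee_fin hkernel_ge0//; lra.
    rewrite integral_mkcond; apply: eq_integral => r _; rewrite patchE /K/= st andbT.
    rewrite mem_setE in_itv/=.
    by case: ifPn.
  rewrite integral0_eq// => r _; rewrite /K/=; case: ifPn => // /and3P[r1 rs s1].
  by case/negP: st; rewrite mem_setE in_itv/= s1 (lt_trans r1).
rewrite (@fubini_tonelli _ _ (measurableTypeR R) (measurableTypeR R) R
  mu mu K mK K0).
rewrite -ge0_integralZl//; last 3 first.
- apply/measurable_EFinP/measurable_funTS/measurable_funM => //.
  exact: measurable_invr.
- move=> r /=; rewrite in_itv/= => /andP[r1 _].
  by rewrite lee_fin divr_ge0//; lra.
- by apply: integral_ge0 => r _; rewrite lee_fin mulr_ge0// powR_ge0.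
rewrite [RHS]integral_mkcond; apply: eq_integral => r _; rewrite patchE.
case: ifPn => [|rt].
  rewrite mem_setE in_itv/= => /andP[r1 rt].
  have r0 : 0 < r by lra.
  rewrite -(@integral_hkernel_beta a r t)// muleC -ge0_integralZl//; last 3 first.
  - apply/measurable_EFinP/measurable_funTS/measurable_funM.
      exact: measurable_hkernelr.
    apply: (measurableT_comp (measurable_powR _)).
    by apply: (measurableT_comp (@measurable_ln R)); exact: measurable_funM.
  - move=> s /=; rewrite in_itv/= => /andP[rs st].
    by rewrite lee_fin mulr_ge0// ?powR_ge0// hkernel_ge0//; lra.
  - by rewrite lee_fin divr_ge0//; lra.
  rewrite [RHS]integral_mkcond; apply: eq_integral => s _; rewrite patchE /K/= r1/=.
  rewrite mem_setE in_itv/=; case: ifPn => // _.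
  by rewrite -EFinM; congr (_%:E); rewrite {2}/hkernel; field; rewrite lt0r_neq0.
rewrite integral0_eq// => s _; rewrite /K/=; case: ifPn => // /and3P[r1 rs st].
by case/negP: rt; rewrite mem_setE in_itv/= r1/= (lt_trans rs).
Qed.

End HadamardSemigroup.

(** * The Hadamard integral as an operator *)

Section HadamardOperator.
Context {R : realType}.
Implicit Types (f g : R -> R) (a b s t tau C : R).
Local Notation mu := (@lebesgue_measure R).

(** The normalization by [Gamma b] is omitted: it is a nonnegative constant
    factor, and only its sign will matter. *)
Definition hadamard b f t : R :=
  \int[mu]_(s in `[1, t]) (hkernel b t s * f s).

Lemma hadamard_intE b f t : hadamard_int b f t = (Gamma b)^-1 * hadamard b f t.
Proof.
congr (_ * _); apply: eq_Rintegral => s _.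
by rewrite /hkernel mulrAC.
Qed.

Lemma measurable_hkernelM b f t tau : measurable_fun `[tau, t] f ->
  measurable_fun `[tau, t] (fun s => hkernel b t s * f s).
Proof.
move=> mf; apply: measurable_funM => //.
by apply: measurable_funTS; exact: measurable_hkernelr.
Qed.

Lemma integrable_hkernelM b f tau t C : 0 < b -> 0 < tau ->
  measurable_fun `[tau, t] f -> {in `[tau, t], forall s, `|f s| <= C} ->
  mu.-integrable `[tau, t] (EFin \o (fun s => hkernel b t s * f s)).
Proof.
move=> b0 tau0 mf fC.
have [tt|tt] := ltP t tau.
  rewrite set_itv_ge; last by rewrite -leNgt bnd_simp.
  exact: integrable_set0.
have C0 : 0 <= C.
  by apply: (le_trans _ (fC tau _)); rewrite ?normr_ge0// in_itv/= lexx.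
have ik : mu.-integrable `[tau, t] (EFin \o hkernel b t).
  apply/integrableP; split.
    apply/measurable_EFinP; apply: measurable_funTS.
    exact: measurable_hkernelr.
  have -> : (\int[mu]_(s in `[tau, t]) `|(EFin \o hkernel b t) s| =
      (ln (t / tau) `^ b / b)%:E)%E; last exact: ltry.
    rewrite -integral_hkernel//; apply: eq_integral => s.
    rewrite inE/= in_itv/= => /andP[ts _].
    by rewrite ger0_norm// hkernel_ge0//; lra.
have iC : mu.-integrable `[tau, t] (EFin \o (fun s => C * hkernel b t s)).
  have -> : EFin \o (fun s => C * hkernel b t s) =
      (fun s => C%:E * (EFin \o hkernel b t) s)%E by apply/funext.
  exact: integrableZl.
apply: le_integrable iC => //.
  by apply/measurable_EFinP; exact: measurable_hkernelM.
move=> s /= st; have := fC s st; move: st; rewrite in_itv/= => /andP[ts _] fsC.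
have k0 : 0 <= hkernel b t s by apply: hkernel_ge0; lra.
rewrite lee_fin normrM (ger0_norm k0) normrM (ger0_norm C0) (ger0_norm k0).
by rewrite mulrC ler_wpM2r.
Qed.

Lemma norm_integral_hkernelM b f tau t C : 0 < b -> 0 < tau -> tau <= t ->
  measurable_fun `[tau, t] f -> {in `[tau, t], forall s, `|f s| <= C} ->
  `|\int[mu]_(s in `[tau, t]) (hkernel b t s * f s)| <=
    C * (ln (t / tau) `^ b / b).
Proof.
move=> b0 tau0 tt mf fC; have ikf := integrable_hkernelM b0 tau0 mf fC.
apply: (le_trans (le_normr_Rintegral _ ikf)) => //.
have ik1 : mu.-integrable `[tau, t] (EFin \o (fun s => hkernel b t s * 1)).
  by apply: (@integrable_hkernelM _ _ _ _ 1) => // s _; rewrite normr1.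
have -> : C * (ln (t / tau) `^ b / b) =
    \int[mu]_(s in `[tau, t]) (C * (hkernel b t s * 1)).
  rewrite RintegralZl//; congr (_ * _).
  under eq_Rintegral do rewrite mulr1.
  by rewrite /Rintegral integral_hkernel.
apply: le_Rintegral => //.
- exact: integrable_norm.
- have -> : EFin \o (fun s => C * (hkernel b t s * 1)) =
      (fun s => C%:E * (EFin \o (fun s => hkernel b t s * 1)%R) s)%E.
    by apply/funext.
  exact: integrableZl.
- move=> s /= st; have := fC s st; move: st; rewrite in_itv/= => /andP[ts _] fsC.
  have k0 : 0 <= hkernel b t s by apply: hkernel_ge0; lra.
  by rewrite normrM (ger0_norm k0) mulr1 mulrC ler_wpM2r.
Qed.

Lemma norm_hadamard_le b f t C : 0 < b -> 1 <= t ->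
  measurable_fun `[1, t] f -> {in `[1, t], forall s, `|f s| <= C} ->
  `|hadamard b f t| <= C * (ln t `^ b / b).
Proof.
move=> b0 t1 mf fC; rewrite -[X in ln X]divr1.
exact: norm_integral_hkernelM.
Qed.

Lemma hadamardB b f g t C : 0 < b ->
  measurable_fun `[1, t] f -> {in `[1, t], forall s, `|f s| <= C} ->
  measurable_fun `[1, t] g -> {in `[1, t], forall s, `|g s| <= C} ->
  hadamard b (fun s => f s - g s) t = hadamard b f t - hadamard b g t.
Proof.
move=> b0 mf fC mg gC; rewrite /hadamard -RintegralB//.
- by apply: eq_Rintegral => s _; rewrite mulrBr.
- exact: integrable_hkernelM fC.
- exact: integrable_hkernelM gC.
Qed.

Lemma eq_hadamard b f g t : {in `[1, t], f =1 g} ->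
  hadamard b f t = hadamard b g t.
Proof.
by move=> fg; apply: eq_Rintegral => s; rewrite inE/= => st; rewrite fg.
Qed.

Lemma EFin_hadamard b f t C : 0 < b -> measurable_fun [set: R] f ->
  (forall s, 0 <= f s <= C) ->
  ((hadamard b f t)%:E =
   \int[mu]_(s in `]1%R, t[) (hkernel b t s * f s)%:E)%E.
Proof.
move=> b0 mf fC.
have mk D : measurable_fun D (EFin \o (fun s => hkernel b t s * f s)).
  apply/measurable_EFinP; apply: measurable_funTS; apply: measurable_funM => //.
  exact: measurable_hkernelr.
have fC' : {in `[1, t], forall s, `|f s| <= C}.
  by move=> s _; have /andP[? ?] := fC s; rewrite ger0_norm.
have ik : mu.-integrable `[1, t] (EFin \o (fun s => hkernel b t s * f s)).
  by apply: integrable_hkernelM fC' => //; exact: measurable_funTS.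
rewrite -(@integral_itv_bndoo _ _ _ _ true false)//.
by rewrite /hadamard /Rintegral fineK//; exact: integrable_fin_num.
Qed.

(** For [f >= 0] the integral, as a function of its upper limit, is a partial
    integral of a nonnegative measurable function of two variables; adding a
    constant to a bounded [f] reduces to this case. *)
Lemma measurable_hadamard b f C : 0 < b -> measurable_fun [set: R] f ->
  (forall s, `|f s| <= C) -> measurable_fun [set: R] (hadamard b f).
Proof.
move=> b0; have pos g (D : R) : measurable_fun [set: R] g ->
    (forall s, 0 <= g s <= D) -> measurable_fun [set: R] (hadamard b g).
  move=> mg gD.
  pose K (p : R * R) : \bar R :=
    if (1 < p.2) && (p.2 < p.1) then (hkernel b p.1 p.2 * g p.2)%:E else 0%E.
  have K0 p : (0 <= K p)%E.
    rewrite /K; case: ifPn => // /andP[p1 p12]; have p2 : 0 <= p.2 by lra.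
    by rewrite lee_fin; apply: mulr_ge0; [exact: hkernel_ge0|case/andP: (gD p.2)].
  have mK : measurable_fun [set: R * R] K.
    apply: measurable_fun_ifT.
    - by apply: measurable_and; exact: measurable_fun_ltr.
    - apply/measurable_EFinP; apply: measurable_funM.
        exact: measurable_hkernel.
      exact: (measurableT_comp mg measurable_snd).
    - exact: measurable_cst.
  have mF := @measurable_fun_fubini_tonelli_F _ _ (measurableTypeR R)
    (measurableTypeR R) R mu K mK K0.
  apply/measurable_EFinP.
  suff -> : EFin \o hadamard b g = (fun t => \int[mu]_s K (t, s))%E by exact: mF.
  apply/funext => t; rewrite /= (EFin_hadamard _ b0 mg gD).
  rewrite integral_mkcond; apply: eq_integral => s _; rewrite patchE /K/=.
  by rewrite mem_setE in_itv/=.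
move=> mf fC; have C0 : 0 <= C := le_trans (normr_ge0 _) (fC 0).
have -> : hadamard b f =
    (fun t => hadamard b (fun s => f s + C) t - hadamard b (cst C) t).
  apply/funext => t; rewrite -(@hadamardB _ _ _ _ (C + C))//.
  - by apply: eq_hadamard => s _; rewrite addrK.
  - by apply: measurable_funD => //; exact: measurable_funTS.
  - by move=> s _; rewrite (le_trans (ler_normD _ _))// (ger0_norm C0) lerD2r.
  - by move=> s _; rewrite /= (ger0_norm C0) lerDl.
apply: measurable_funB.
  apply: (pos _ (C + C)); first exact: measurable_funD.
  by move=> s; have := fC s; rewrite ler_norml => /andP[? ?]; apply/andP; split; lra.
by apply: (pos _ C) => // s; rewrite lexx C0.
Qed.

Definition beta a : R := fine (beta_integral a).

(** Take [f = 1] and [t = 2] in [ge0_hkernel_tonelli]: the left-hand side is the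
    integral of an integrable function, and on the right-hand side the constant
    is multiplied by [ln 2 > 0]. *)
Lemma beta_integral_fin a : 0 < a -> a < 1 -> beta_integral a \is a fin_num.
Proof.
move=> a0 a1.
have H := @ge0_hkernel_tonelli R a (cst 1) 2 (measurable_cst _) (fun=> ler01).
have m1 : measurable_fun [set: R] (cst (1 : R)) by exact: measurable_cst.
have b1 : forall s : R, 0 <= cst (1 : R) s <= 1 by move=> s; rewrite ler01 lexx.
have a10 : 0 < 1 - a by lra.
have g0 s : 0 <= hadamard a (cst 1) s.
  apply: Rintegral_ge0 => r /=; rewrite in_itv/= => /andP[r1 _].
  by rewrite mulr1 hkernel_ge0//; lra.
have E1 : (\int[mu]_(s in `]1%R, (2 : R)%R[) ((hkernel (1 - a) (2 : R)%R s)%:E *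
      \int[mu]_(r in `]1%R, s[) (hkernel a s r * cst 1 r)%:E) < +oo)%E.
  under eq_integral do rewrite -(EFin_hadamard _ a0 m1 b1) -EFinM.
  rewrite -(@integral_itv_bndoo _ _ _ _ true false); last first.
    apply/measurable_EFinP; apply: measurable_funTS; apply: measurable_funM.
      exact: measurable_hkernelr.
    by apply: (@measurable_hadamard _ _ 1) => // s; rewrite normr1.
  apply: integrable_lty => //.
  apply: (@integrable_hkernelM _ _ _ _ (ln 2 `^ a / a)) => //.
    apply: measurable_funTS.
    by apply: (@measurable_hadamard _ _ 1) => // s; rewrite normr1.
  move=> s; rewrite in_itv/= => /andP[s1 s2].
  have -> : ln 2 `^ a / a = 1 * (ln 2 `^ a / a) by rewrite mul1r.
  apply: (@le_trans _ _ (1 * (ln s `^ a / a))).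
    by apply: norm_hadamard_le => // r _; rewrite normr1.
  rewrite !mul1r ler_pM2r ?invr_gt0//.
  apply: ge0_ler_powR; rewrite ?nnegrE ?ln_ge0 ?(ltW a0)//; first by lra.
  by rewrite ler_ln ?posrE//; lra.
rewrite H in E1.
have E2 : (\int[mu]_(r in `]1%R, (2 : R)%R[) (cst 1 r / r)%:E)%E = (ln 2)%:E.
  have -> : ln 2 = ln (2 / 1) `^ 1 / 1 :> R.
    by rewrite !divr1 powRr1// ln_ge0//; lra.
  rewrite -(@integral_hkernel _ 1 1 2)//; last by lra.
  rewrite (@integral_itv_bndoo _ _ _ _ true false); last first.
    apply/measurable_EFinP; apply: measurable_funTS; exact: measurable_hkernelr.
  by apply: eq_integral => r _; rewrite /hkernel subrr powRr0.
have B1 := beta_integral_ge1 a0 a1.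
rewrite ge0_fin_numE; last exact: le_trans B1.
rewrite ltey; apply/eqP => Boo; move: E1; rewrite Boo E2 gt0_mulye ?ltxx//.
by rewrite lte_fin ln_gt0//; lra.
Qed.

End HadamardOperator.

(** * Inversion of the Hadamard integral, and growth of its kernel *)

Section HadamardExtremum.
Context {R : realType}.
Implicit Types (f g h : R -> R) (a b s t u tau C D K M : R).
Local Notation mu := (@lebesgue_measure R).

Lemma hkernel1 t s : hkernel 1 t s = s^-1.
Proof. by rewrite /hkernel subrr powRr0 mul1r. Qed.

Lemma hadamard_le1 b f t : t <= 1 -> hadamard b f t = 0.
Proof.
rewrite le_eqVlt => /predU1P[->|t1].
  by rewrite /hadamard set_itv1 Rintegral_set1.
rewrite /hadamard set_itv_ge ?Rintegral_set0//.
by rewrite -leNgt bnd_simp.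
Qed.

Lemma hadamard0 b t : hadamard b (cst (0 : R)) t = 0.
Proof.
rewrite /hadamard; under eq_Rintegral do rewrite mulr0.
by rewrite /Rintegral integral0.
Qed.

Lemma hadamard_bounded_itv b f t C : 0 < b -> 1 <= t ->
  measurable_fun [set: R] f -> (forall s, `|f s| <= C) ->
  {in `[1, t], forall s, `|hadamard b f s| <= C * (ln t `^ b / b)}.
Proof.
move=> b0 t1 mf fC s; rewrite in_itv/= => /andP[s1 st].
have C0 : 0 <= C := le_trans (normr_ge0 _) (fC 0).
apply: (@le_trans _ _ (C * (ln s `^ b / b))).
  by apply: norm_hadamard_le => //; exact: measurable_funTS.
rewrite ler_wpM2l// ler_pM2r ?invr_gt0//.
apply: ge0_ler_powR; rewrite ?nnegrE ?ln_ge0 ?(ltW b0)//.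
by rewrite ler_ln ?posrE//; lra.
Qed.

(** Abel's inversion: [f] is recovered from its integral of order [a] by a
    further integration of order [1 - a] and one differentiation. *)
Lemma hadamard_comp a f t C : 0 < a -> a < 1 -> measurable_fun [set: R] f ->
  (forall s, `|f s| <= C) ->
  hadamard (1 - a) (hadamard a f) t = beta a * hadamard 1 f t.
Proof.
move=> a0 a1 mf fC; have b0 : 0 < 1 - a by lra.
have [t1|t1] := leP t 1; first by rewrite !hadamard_le1// mulr0.
have pos g (D : R) : measurable_fun [set: R] g -> (forall s, 0 <= g s <= D) ->
    hadamard (1 - a) (hadamard a g) t = beta a * hadamard 1 g t.
  move=> mg gD; have gD' s : `|g s| <= D.
    by have /andP[? ?] := gD s; rewrite ger0_norm.
  have mh := measurable_hadamard a0 mg gD'.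
  apply: EFin_inj; rewrite EFinM (EFin_hadamard _ ltr01 mg gD).
  rewrite /beta [in RHS]fineK ?beta_integral_fin//.
  under [in RHS]eq_integral do rewrite hkernel1 mulrC.
  rewrite -ge0_hkernel_tonelli//; last by move=> s; case/andP: (gD s).
  under [in RHS]eq_integral do rewrite -(EFin_hadamard _ a0 mg gD) -EFinM.
  rewrite -(@integral_itv_bndoo _ _ _ _ true false); last first.
    apply/measurable_EFinP; apply: measurable_funTS; apply: measurable_funM => //.
    exact: measurable_hkernelr.
  rewrite /hadamard /Rintegral fineK//; apply: integrable_fin_num => //.
  apply: (@integrable_hkernelM _ _ _ _ _ (D * (ln t `^ a / a))) => //.
    exact: measurable_funTS.
  by apply: hadamard_bounded_itv => //; exact: ltW.
have C0 : 0 <= C := le_trans (normr_ge0 _) (fC 0).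
have mfC : measurable_fun [set: R] (fun s => f s + C) by exact: measurable_funD.
have fC2 s : 0 <= f s + C <= C + C.
  by have := fC s; rewrite ler_norml => /andP[? ?]; apply/andP; split; lra.
have cC s : 0 <= cst C s <= C + C by rewrite /=; apply/andP; split; lra.
have cfC s : `|f s + C| <= C + C by have /andP[? ?] := fC2 s; rewrite ger0_norm.
have ccC s : `|cst C s| <= C + C by have /andP[? ?] := cC s; rewrite ger0_norm.
have mC : measurable_fun [set: R] (cst C) by exact: measurable_cst.
have split b : 0 < b -> forall s,
    hadamard b f s = hadamard b (fun s => f s + C) s - hadamard b (cst C) s.
  move=> bb s; rewrite -(@hadamardB _ _ _ _ _ (C + C))//.
  - by apply: eq_hadamard => r _; rewrite addrK.
  - exact: measurable_funTS.
(* f is the difference of the nonnegative functions f + C and C *)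
rewrite (split 1)// mulrBr -(pos _ (C + C))// -(pos _ (C + C))//.
rewrite -(@hadamardB _ _ _ _ _ ((C + C) * (ln t `^ a / a)))//.
- by apply: eq_hadamard => s _; exact: split.
- by apply: measurable_funTS; exact: (@measurable_hadamard _ _ _ (C + C)).
- by apply: hadamard_bounded_itv => //; exact: ltW.
- by apply: measurable_funTS; exact: (@measurable_hadamard _ _ _ (C + C)).
- by apply: hadamard_bounded_itv => //; exact: ltW.
Qed.

Lemma is_derive_hadamard1 f t u C : 1 < t -> t < u ->
  measurable_fun `[1, u] f -> {in `[1, u], forall s, `|f s| <= C} ->
  {for t, continuous f} -> is_derive t 1 (hadamard 1 f) (f t / t).
Proof.
move=> t1 tu mf fC cf.
have ik := integrable_hkernelM ltr01 ltr01 mf fC.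
have E : EFin \o (fun s => hkernel 1 u s * f s) = EFin \o (fun s => s^-1 * f s).
  by apply/funext => s /=; rewrite hkernel1.
rewrite E in ik.
have H : hadamard 1 f = (fun x => \int[mu]_(s in `[1, x]) (s^-1 * f s)).
  by apply/funext => x; apply: eq_Rintegral => s _; rewrite hkernel1.
have ct : {for t, continuous (fun s => s^-1 * f s)}.
  apply: continuousM => //; apply: continuousV; last exact: cvg_id.
  by rewrite lt0r_neq0//; lra.
have [dH H'] := continuous_FTC1_closed tu ik t1 ct.
rewrite H; split; first exact: dH.
by rewrite -derive1E H' mulrC.
Qed.

Lemma continuous_hadamard1 f u C : 1 <= u ->
  measurable_fun `[1, u] f -> {in `[1, u], forall s, `|f s| <= C} ->
  {within `[1, u], continuous (hadamard 1 f)}.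
Proof.
move=> u1 mf fC.
have ik := integrable_hkernelM ltr01 ltr01 mf fC.
have E : EFin \o (fun s => hkernel 1 u s * f s) = EFin \o (fun s => s^-1 * f s).
  by apply/funext => s /=; rewrite hkernel1.
rewrite E in ik.
have H : hadamard 1 f = (fun x => \int[mu]_(s in `[1, x]) (s^-1 * f s)).
  by apply/funext => x; apply: eq_Rintegral => s _; rewrite hkernel1.
by rewrite H; exact: (parameterized_integral_continuous u1 ik).
Qed.

(** If [g] vanishes up to time [tau], then [tau] replaces the base point 1; this
    is what makes the estimates below depend on [t / tau] only. *)
Lemma hadamard_support b g tau t : 1 <= tau ->
  {in `[1, tau], forall s, g s = 0} ->
  hadamard b g t = \int[mu]_(s in `[tau, t]) (hkernel b t s * g s).
Proof.
move=> tau1 g0; rewrite /hadamard Rintegral_mkcond [RHS]Rintegral_mkcond.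
apply: eq_Rintegral => s _; rewrite !patchE !mem_setE !in_itv/=.
have [st|] := leP s t; last by rewrite !andbF.
rewrite !andbT; case: ifPn => [s1|s1].
  case: ifPn => // ts; rewrite g0 ?mulr0// in_itv/= s1/= ltW//.
  by rewrite -ltNge in ts.
by rewrite ifF//; apply/negP => ts; case/negP: s1; exact: le_trans ts.
Qed.

Lemma hkernel_anti b s t t0 : b <= 1 -> 0 < s -> s < t -> t <= t0 ->
  hkernel b t0 s <= hkernel b t s.
Proof.
move=> b1 s0 st tt; rewrite /hkernel ler_pM2r ?invr_gt0//.
have l0 : 0 < ln (t / s) by rewrite ln_gt0// div_gt1.
have l1 : ln (t / s) <= ln (t0 / s).
  by rewrite ler_ln ?posrE ?divr_gt0//; [rewrite ler_pM2r ?invr_gt0//|lra|lra].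
have -> : b - 1 = - (1 - b) by ring.
rewrite !powRN lef_pV2 ?posrE ?powR_gt0//; last exact: lt_le_trans l1.
apply: ge0_ler_powR; rewrite ?nnegrE; first by lra.
- exact: ltW.
- by apply: ltW; exact: lt_le_trans l1.
- by [].
Qed.

(** When the upper limit moves from [t] to [t0], the kernel of order at most 1
    decreases on the old interval, so that only the new interval [[t, t0]]
    contributes to the growth. *)
Lemma integral_hkernel_growth b h tau t t0 D K : 0 < b -> b <= 1 ->
  0 < tau -> tau <= t -> t <= t0 ->
  measurable_fun [set: R] h -> {in `[tau, t0], forall s, 0 <= h s <= D} ->
  {in `[t, t0], forall s, h s <= K} ->
  \int[mu]_(s in `[tau, t0]) (hkernel b t0 s * h s) <=
  \int[mu]_(s in `[tau, t]) (hkernel b t s * h s) + K * (ln (t0 / t) `^ b / b).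
Proof.
move=> b0 b1 tau0 taut tt mh hD hK.
have hn x y : tau <= x -> y <= t0 -> {in `[x, y], forall s, `|h s| <= D}.
  move=> taux yt0 s; rewrite in_itv/= => /andP[xs sy].
  have /hD/andP[h0 ?] : s \in `[tau, t0] by rewrite in_itv/=; apply/andP; split; lra.
  by rewrite ger0_norm.
have ik0 : mu.-integrable `[tau, t0] (EFin \o (fun s => hkernel b t0 s * h s)).
  by apply: (@integrable_hkernelM _ _ _ _ _ D) => //; [exact: measurable_funTS|exact: hn].
have ik1 : mu.-integrable `[tau, t] (EFin \o (fun s => hkernel b t s * h s)).
  by apply: (@integrable_hkernelM _ _ _ _ _ D) => //; [exact: measurable_funTS|exact: hn].
have subl : `[tau, t[ `<=` `[tau, t0]%classic.
  by move=> s /=; rewrite !in_itv/= => /andP[? ?]; apply/andP; split; lra.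
have subt : `[tau, t[ `<=` `[tau, t]%classic.
  by move=> s /=; rewrite !in_itv/= => /andP[? ?]; apply/andP; split; lra.
rewrite (@itv_bndbnd_setU _ _ _ (BLeft t)) ?bnd_simp//.
rewrite Rintegral_setU//=; last 2 first.
- by rewrite -itv_bndbnd_setU ?bnd_simp.
- apply/disj_setPS => y [/=]; rewrite !in_itv/= => /andP[_ yt] /andP[ty _].
  by move: yt; rewrite ltNge ty.
apply: lerD; last first.
  apply: (le_trans (ler_norm _)); apply: norm_integral_hkernelM => //.
  - by lra.
  - exact: measurable_funTS.
  - move=> s st; rewrite ger0_norm; first exact: hK.
    move: st; rewrite in_itv/= => /andP[ts st].
    have /hD/andP[] // : s \in `[tau, t0] by rewrite in_itv/=; apply/andP; split; lra.
rewrite -[leRHS]Rintegral_itv_bndo_bndc; last exact: integrableS ik1.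
apply: le_Rintegral => //; [exact: integrableS ik0|exact: integrableS ik1|].
move=> s /=; rewrite in_itv/= => /andP[ts st].
have /hD/andP[h0 _] : s \in `[tau, t0] by rewrite in_itv/=; apply/andP; split; lra.
by rewrite ler_wpM2r// hkernel_anti//; lra.
Qed.

Lemma hadamard_vanish b f tau t : {in `[1, tau], forall s, f s = 0} ->
  t <= tau -> hadamard b f t = 0.
Proof.
move=> f0 tt; rewrite -[RHS](hadamard0 b t); apply: eq_hadamard => r.
by rewrite in_itv/= => /andP[r1 rt]; rewrite f0// in_itv/= r1 (le_trans rt).
Qed.

Lemma cvg_subr_dnbhs t : s - t @[s --> t^'] --> (0 : R)^'.
Proof.
have H := @continuous_injective_withinNx R R (fun s => s - t) t.
rewrite subrr in H; apply: H.
  by apply: cvgB; [exact: cvg_id|exact: cvg_cst].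
by move=> y /= /eqP; rewrite ?subrr subr_eq0 => /eqP.
Qed.

Lemma is_derive_quotient t f (d : R) :
  is_derive t 1 f d -> (f s - f t) / (s - t) @[s --> t^'] --> d.
Proof.
move=> [df Df]; have : x^-1 *: (f (x *: 1 + t) - f t) @[x --> (0 : R)^'] --> d.
  by rewrite -Df.
move=> /(cvg_comp _ _ (cvg_subr_dnbhs t)).
apply: cvg_trans; apply: near_eq_cvg; near=> s.
by rewrite /= /GRing.scale/= mulr1 subrK mulrC.
Unshelve. all: by end_near. Qed.

Lemma quotient_is_derive t f (d : R) :
  (f s - f t) / (s - t) @[s --> t^'] --> d -> is_derive t 1 f d.
Proof.
move=> H.
have H0 : x *: 1 + t @[x --> (0 : R)^'] --> t^'.
  have := @continuous_injective_withinNx R R (fun x => x *: 1 + t) 0.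
  rewrite scale0r add0r; apply.
    apply: cvgD; last exact: cvg_cst.
    by apply: cvgZr_tmp; exact: cvg_id.
  move=> y /= /eqP; rewrite ?scale0r ?add0r /GRing.scale/= mulr1.
  by rewrite -subr_eq0 addrK => /eqP.
have {H0}H : x^-1 *: (f (x *: 1 + t) - f t) @[x --> (0 : R)^'] --> d.
  apply: cvg_near_eq (cvg_comp _ _ H0 H); near=> x.
  by rewrite /= addrK /GRing.scale/= mulr1 mulrC.
split; first by apply/cvg_ex; exists d.
exact/cvg_lim.
Unshelve. all: by end_near. Qed.

End HadamardExtremum.

(** * A lower bound at a maximum of the fractional integral *)

Section VolterraExtremum.
Context {R : realType}.
Implicit Types (f g : R -> R) (a b e s t u tau C D K M : R).
Local Notation mu := (@lebesgue_measure R).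

Lemma norm_le_subr_bounds M (z : R) : `|z| <= M -> 0 <= M - z <= M + M.
Proof. by rewrite ler_norml => /andP[? ?]; apply/andP; split; lra. Qed.

Lemma is_derive_powR_ln b tau t : 0 < tau -> tau < t ->
  is_derive t 1 (fun t => ln (t / tau) `^ b) (b * ln (t / tau) `^ (b - 1) / t).
Proof.
move=> tau0 taut; have t0 : 0 < t := lt_trans tau0 taut.
have tt0 : 0 < t / tau by rewrite divr_gt0.
have l0 : 0 < ln (t / tau) by rewrite ln_gt0// div_gt1.
have d1 : is_derive t 1 (fun t => t / tau) (tau^-1).
  have -> : (fun t => t / tau) = tau^-1 \*: id.
    by apply/funext => x /=; rewrite /GRing.scale/= mulrC.
  by rewrite -[X in is_derive _ _ _ X]mulr1; exact: is_deriveZ.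
have d2 := @is_derive1_comp _ (@ln R) (fun t => t / tau) t _ _
  (is_derive1_ln tt0) d1.
have d3 := @is_derive1_comp _ (@powR R ^~ b) (@ln R \o (fun t => t / tau)) t _ _
  (is_derive1_powR b l0) d2.
have -> : b * ln (t / tau) `^ (b - 1) / t =
    b * ln (t / tau) `^ (b - 1) * ((t / tau)^-1 * tau^-1).
  by field; rewrite !lt0r_neq0.
exact: d3.
Qed.

(** Put [H = M ln(t / tau)^(1 - a) / (1 - a) - beta a * F] with [F] the integral
    of [f / s]. By [hadamard_comp], [H] is the integral of order [1 - a] of
    [M - hadamard a f >= 0] from [tau] on, so that [integral_hkernel_growth]
    bounds its increase from [s] to [t0]. The integrand vanishes at [t0] at
    linear rate, by the Lipschitz hypothesis, and the new interval therefore
    contributes [o(t0 - s)]. Hence [H' t0 <= 0], which is the claim. *)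
Lemma hadamard_extremum a tau t0 C K M e f : 0 < a -> a < 1 ->
  1 <= tau -> tau < t0 ->
  measurable_fun [set: R] f -> (forall s, `|f s| <= C) ->
  {in `[1, tau], forall s, f s = 0} -> {for t0, continuous f} ->
  {in `[1, t0], forall s, `|hadamard a f s| <= M} -> hadamard a f t0 = M ->
  0 < e -> 0 <= K ->
  (forall s, t0 - e < s -> s < t0 -> M - hadamard a f s <= K * (t0 - s)) ->
  M * ln (t0 / tau) `^ (1 - a - 1) <= beta a * f t0.
Proof.
move=> a0 a1 tau1 tt mf fC f0 cf gM gt0 e0 K0 gK.
have b0 : 0 < 1 - a by lra.
have b1 : 1 - a <= 1 by lra.
have tau0 : 0 < tau by lra.
have mg := measurable_hadamard a0 mf fC.
pose H t := M * (ln (t / tau) `^ (1 - a) / (1 - a)) - beta a * hadamard 1 f t.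
have HE t : tau <= t -> t <= t0 ->
    H t = \int[mu]_(s in `[tau, t]) (hkernel (1 - a) t s * (M - hadamard a f s)).
  move=> taut t1.
  have gM' : {in `[tau, t], forall s, `|hadamard a f s| <= M}.
    move=> s; rewrite in_itv/= => /andP[ts st]; apply: gM.
    by rewrite in_itv/=; apply/andP; split; lra.
  have ik1 : mu.-integrable `[tau, t]
      (EFin \o (fun s => hkernel (1 - a) t s * M)).
    by apply: (@integrable_hkernelM _ _ _ _ _ `|M|) => // s _; exact: measurable_cst.
  have ikc : mu.-integrable `[tau, t]
      (EFin \o (fun s => hkernel (1 - a) t s * 1)).
    by apply: (@integrable_hkernelM _ _ _ _ _ `|1|) => // s _; exact: measurable_cst.
  have ik2 : mu.-integrable `[tau, t]
      (EFin \o (fun s => hkernel (1 - a) t s * hadamard a f s)).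
    by apply: (@integrable_hkernelM _ _ _ _ _ M) => //; exact: measurable_funTS.
  under eq_Rintegral do rewrite mulrBr.
  rewrite RintegralB// /H -(hadamard_comp t a0 a1 mf fC); congr (_ - _); last first.
    apply: hadamard_support => // s; rewrite in_itv/= => /andP[_ st].
    exact: hadamard_vanish f0 st.
  have -> : (fun s => hkernel (1 - a) t s * M) =
      (fun s => M * (hkernel (1 - a) t s * 1)).
    by apply/funext => s; rewrite mulr1 mulrC.
  rewrite RintegralZl//; congr (_ * _).
  under eq_Rintegral do rewrite mulr1.
  by rewrite /Rintegral integral_hkernel.
have growth s : tau < s -> t0 - e < s -> s < t0 ->
    H t0 - H s <= K * (t0 - s) * (ln (t0 / s) `^ (1 - a) / (1 - a)).
  move=> ts es st; rewrite lerBlDl HE ?(ltW tt)// HE ?(ltW ts) ?(ltW st)//.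
  apply: (@integral_hkernel_growth _ _ _ _ _ _ (M + M)) => //.
  - exact: ltW.
  - exact: ltW.
  - by apply: measurable_funB => //; exact: measurable_cst.
  - move=> r; rewrite in_itv/= => /andP[tr rt].
    have : r \in `[1, t0] by rewrite in_itv/=; apply/andP; split; lra.
    by move=> /gM; exact: norm_le_subr_bounds.
  - move=> r; rewrite in_itv/= => /andP[sr].
    rewrite le_eqVlt => /predU1P[->|rt].
      by rewrite gt0 subrr mulr_ge0//; lra.
    apply: (le_trans (gK _ _ _)) => //; first by lra.
    by rewrite ler_wpM2l//; lra.
have t00 : 0 < t0 by lra.
have dF : is_derive t0 1 (hadamard 1 f) (f t0 / t0).
  apply: (@is_derive_hadamard1 _ _ _ (t0 + 1) C) => //; first by lra.
  - by lra.
  - exact: measurable_funTS.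
have dH : is_derive t0 1 H
    (M * ln (t0 / tau) `^ (1 - a - 1) / t0 - beta a * f t0 / t0).
  have d1 := is_deriveZ (M / (1 - a))
    (is_derive_powR_ln (1 - a) tau0 tt).
  have d2 := is_deriveZ (beta a) dF.
  have -> : H = (M / (1 - a)) \*: (fun t => ln (t / tau) `^ (1 - a)) -
      beta a \*: hadamard 1 f.
    apply/funext => t.
    change (M * (ln (t / tau) `^ (1 - a) / (1 - a)) - beta a * hadamard 1 f t =
      M / (1 - a) * ln (t / tau) `^ (1 - a) - beta a * hadamard 1 f t).
    by rewrite mulrA [in RHS]mulrAC.
  have -> : M * ln (t0 / tau) `^ (1 - a - 1) / t0 - beta a * f t0 / t0 =
    (M / (1 - a)) *: ((1 - a) * ln (t0 / tau) `^ (1 - a - 1) / t0) -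
    beta a *: (f t0 / t0).
    by rewrite /GRing.scale/=; field; rewrite !lt0r_neq0.
  exact: is_deriveB.
clearbody H.
have q := cvg_dnbhs_at_left (is_derive_quotient dH).
(* the bound on the difference quotient of H at t0 tends to 0 *)
have r : K * (ln (t0 / s) `^ (1 - a) / (1 - a)) @[s --> t0^'-] --> 0.
  have := continuous_powR_ln_div b0 tau0 tt.
  move/(continuous_within_itvP _ tt) => [_ _].
  rewrite divff ?lt0r_neq0// ln1 powR0 ?lt0r_neq0// mul0r oppr0 => /cvgN.
  rewrite oppr0 => H1.
  have H2 : K * (- (fun s => - (ln (t0 / s) `^ (1 - a) / (1 - a)))) s
      @[s --> t0^'-] --> K * 0 by apply: cvgM => //; exact: cvg_cst.
  rewrite mulr0 in H2; apply: cvg_near_eq H2; apply: nearW => s.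
  by congr (_ * _); exact: opprK.
have : M * ln (t0 / tau) `^ (1 - a - 1) / t0 - beta a * f t0 / t0 <= 0.
  apply: (ler_cvg_to q r); near=> s.
  have st : s < t0 by near: s; exact: nbhs_left_lt.
  have ts : tau < s by near: s; exact: nbhs_left_gt.
  have es : t0 - e < s by near: s; apply: nbhs_left_gt; rewrite ltrBlDr ltrDl.
  have -> : (H s - H t0) / (s - t0) = (H t0 - H s) / (t0 - s).
    by rewrite -(opprB (H t0)) -(opprB t0 s) invrN mulrNN.
  by rewrite ler_pdivrMr ?subr_gt0// mulrAC; exact: growth.
by rewrite subr_le0 ler_pM2r// invr_gt0.
Unshelve. all: by end_near. Qed.

End VolterraExtremum.

(** * Positivity of w / t + int w / s^2 at a maximum of the fractional integral *)

Section VolterraPositivity.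
Context {R : realType}.
Implicit Types (f g : R -> R) (a b e s t u tau C D K M : R).
Local Notation mu := (@lebesgue_measure R).

(** By [hadamard_comp] the left-hand side is the integral of order [1 - a] of
    [hadamard a f], which is bounded by [M] and vanishes before [tau]. *)
Lemma hadamard1_bound a tau t0 C M f : 0 < a -> a < 1 -> 1 <= tau ->
  measurable_fun [set: R] f -> (forall s, `|f s| <= C) ->
  {in `[1, tau], forall s, f s = 0} ->
  {in `[1, t0], forall s, `|hadamard a f s| <= M} ->
  forall t, tau <= t -> t <= t0 ->
  `|beta a * hadamard 1 f t| <= M * (ln (t0 / tau) `^ (1 - a) / (1 - a)).
Proof.
move=> a0 a1 tau1 mf fC f0 gM t taut tt; have b0 : 0 < 1 - a by lra.
have M0 : 0 <= M.
  by apply: (le_trans _ (gM 1 _)); rewrite ?normr_ge0// in_itv/=; apply/andP; split; lra.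
have tau0 : 0 < tau by lra.
rewrite -(hadamard_comp t a0 a1 mf fC) (@hadamard_support _ _ _ tau)//; last first.
  by move=> s; rewrite in_itv/= => /andP[_ st]; exact: hadamard_vanish f0 st.
apply: (@le_trans _ _ (M * (ln (t / tau) `^ (1 - a) / (1 - a)))).
  apply: norm_integral_hkernelM => //.
    by apply: measurable_funTS; exact: measurable_hadamard fC.
  move=> s; rewrite in_itv/= => /andP[ts st]; apply: gM.
  by rewrite in_itv/=; apply/andP; split; lra.
rewrite ler_wpM2l// ler_pM2r ?invr_gt0//.
have t1 : 1 <= t / tau by rewrite ler_pdivlMr// mul1r.
have t2 : t / tau <= t0 / tau by rewrite ler_pM2r ?invr_gt0.
apply: ge0_ler_powR; rewrite ?nnegrE; first by lra.
- exact: ln_ge0.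
- by apply: ln_ge0; lra.
- by rewrite ler_ln ?posrE//; lra.
Qed.

Lemma beta_gt0 a : 0 < a -> a < 1 -> 0 < beta a :> R.
Proof.
move=> a0 a1; have := @beta_integral_ge1 R _ a0 a1.
rewrite -(fineK (beta_integral_fin a0 a1)) lee_fin => H.
exact: lt_le_trans H.
Qed.

(** Integration by parts: with [F = hadamard 1 f], the function
    [hadamard 1 (f / s) - F / t] has derivative [F / t ^ 2] and vanishes at
    [tau]. *)
Lemma hadamard1_div_lower tau t0 C S f : 1 <= tau -> tau < t0 ->
  measurable_fun [set: R] f -> (forall s, `|f s| <= C) -> continuous f ->
  {in `[1, tau], forall s, f s = 0} ->
  (forall t, tau <= t -> t <= t0 -> `|hadamard 1 f t| <= S) ->
  - (S / t0 + S * ((t0 - tau) / tau ^+ 2)) <= hadamard 1 (fun s => f s / s) t0.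
Proof.
move=> tau1 tt mf fC cf f0 FS.
have mfs : measurable_fun [set: R] (fun s => f s / s).
  by apply: measurable_funM => //; exact: measurable_invr.
have C0 : 0 <= C := le_trans (normr_ge0 _) (fC 0).
have S0 : 0 <= S by apply: le_trans (FS tau _ _); rewrite ?normr_ge0//; lra.
have fsC u : {in `[1, u], forall s, `|f s / s| <= C}.
  move=> s; rewrite in_itv/= => /andP[s1 _]; rewrite normrM normfV.
  rewrite (ger0_norm (le_trans ler01 s1)) ler_pdivrMr; last by lra.
  by rewrite (le_trans (fC s))// ler_peMr.
pose Q t := hadamard 1 (fun s => f s / s) t - hadamard 1 f t * t^-1.
have dQ x : x \in `]tau, t0[ -> is_derive x 1 Q (hadamard 1 f x * x ^- 2).
  rewrite in_itv/= => /andP[tx xt].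
  have x0 : x != 0 by rewrite lt0r_neq0//; lra.
  have x1 : 1 < x by lra.
  have xu : x < x + 1 by lra.
  have cfs : {for x, continuous (fun s => f s / s)}.
    by apply: continuousM; [exact: cf|apply: continuousV => //; exact: cvg_id].
  have d1 := is_derive_hadamard1 x1 xu (measurable_funTS mfs) (fsC _) cfs.
  have d2 := is_derive_hadamard1 x1 xu (measurable_funTS mf) (in1W fC) (@cf x).
  have d3 : is_derive x 1 (fun y : R => y^-1) (- x ^- 2 *: 1).
    by apply: is_deriveV.
  have d4 := is_deriveM d2 d3.
  have -> : hadamard 1 f x * x ^- 2 = f x / x / x -
      (hadamard 1 f x *: (- x ^- 2 *: 1) + x^-1 *: (f x / x)).
    by rewrite /GRing.scale/=; field.
  exact: is_deriveB d1 d4.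
have cQ : {within `[tau, t0], continuous Q}.
  have sub : `[tau, t0] `<=` `[1, t0]%classic.
    by move=> s /=; rewrite !in_itv/= => /andP[? ?]; apply/andP; split; lra.
  apply: continuous_subspaceW sub _.
  have c1 : {within `[1, t0], continuous (hadamard 1 (fun s => f s / s))}.
    apply: (@continuous_hadamard1 _ _ _ C) => //; first by lra.
    exact: measurable_funTS.
  have c2 : {within `[1, t0], continuous (hadamard 1 f)}.
    apply: (@continuous_hadamard1 _ _ _ C) => //; first by lra.
    exact: measurable_funTS.
  have c3 : {within `[1, t0], continuous (fun x : R => x^-1)}.
    apply: continuous_in_subspaceT => x; rewrite inE/= in_itv/= => /andP[x1 _].
    by apply: continuousV; [rewrite lt0r_neq0//; lra|exact: cvg_id].
  move=> x; apply: continuousB; first exact: c1.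
  by apply: continuousM; [exact: c2|exact: c3].
have [x xin QE] := MVT tt dQ cQ.
have Q0 : Q tau = 0.
  rewrite /Q (@hadamard_vanish _ _ f tau)// mul0r subr0.
  apply: (@hadamard_vanish _ _ _ tau) => // s st.
  by rewrite f0// mul0r.
move: xin; rewrite in_itv/= => /andP[tx xt].
have x0 : 0 < x by lra.
have QS : - (S * ((t0 - tau) / tau ^+ 2)) <= Q t0.
  rewrite -[Q t0]subr0 -Q0 QE mulrA mulrAC -mulNr ler_wpM2r//; first by lra.
  have : `|hadamard 1 f x * x ^- 2| <= S / tau ^+ 2.
    rewrite normrM normfV (@ger0_norm _ (x ^+ 2)) ?sqr_ge0//.
    apply: ler_pM; rewrite ?invr_ge0 ?sqr_ge0//.
      by apply: FS; exact: ltW.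
    by rewrite lef_pV2 ?posrE ?exprn_gt0//; [rewrite lerXn2r ?nnegrE//; lra|lra].
  by rewrite ler_norml => /andP[].
have : `|hadamard 1 f t0 * t0^-1| <= S / t0.
  rewrite normrM normfV (@ger0_norm _ t0); last by lra.
  by rewrite ler_pM2r ?invr_gt0; [apply: FS; lra|lra].
rewrite ler_norml => /andP[H _].
move: QS H; rewrite /Q; move: (hadamard 1 f t0 * t0^-1) (hadamard 1 _ t0).
by move=> y z; lra.
Qed.

(** With [l = ln (t0 / tau)] and [A = M l^(- a) / beta a], the first term is at
    least [A / t0] by [hadamard_extremum]. The second one is at least
    [- 2 S / t0] where [S = A l / (1 - a)] bounds [hadamard 1 f], and [l] is at
    most [(1 - a) / 8]. *)
Lemma hadamard_volterra_gt0 a tau t0 C K M e f : 0 < a -> a < 1 ->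
  1 <= tau -> tau < t0 -> t0 <= (1 + (1 - a) / 8) * tau ->
  (forall s, `|f s| <= C) -> continuous f ->
  {in `[1, tau], forall s, f s = 0} ->
  {in `[1, t0], forall s, `|hadamard a f s| <= M} -> hadamard a f t0 = M ->
  0 < M -> 0 < e -> 0 <= K ->
  (forall s, t0 - e < s -> s < t0 -> M - hadamard a f s <= K * (t0 - s)) ->
  0 < f t0 / t0 + hadamard 1 (fun s => f s / s) t0.
Proof.
move=> a0 a1 tau1 tt tq fC cf f0 gM gt0 M0 e0 K0 gK.
have mf : measurable_fun [set: R] f by exact: continuous_measurable_fun.
have tau0 : 0 < tau by lra.
have t00 : 0 < t0 by lra.
have B0 := beta_gt0 a0 a1.
have low := hadamard_extremum a0 a1 tau1 tt mf fC f0 (@cf t0) gM gt0 e0 K0 gK.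
have up := hadamard1_bound a0 a1 tau1 mf fC f0 gM.
set l := ln (t0 / tau) in low up.
have b0 : 0 < 1 - a by lra.
have l0 : 0 < l by rewrite ln_gt0// div_gt1.
have l1 : l <= (1 - a) / 8.
  have -> : l = ln (1 + (t0 / tau - 1)) by rewrite subrKC.
  have q1 : t0 / tau <= 1 + (1 - a) / 8 by rewrite ler_pdivrMr.
  have q0 : 1 < t0 / tau by exact: div_gt1.
  apply: (@le_trans _ _ (t0 / tau - 1)); last by lra.
  by apply: le_ln1Dx; lra.
set P := l `^ (1 - a - 1) in low.
have P0 : 0 < P by rewrite powR_gt0.
(* the two bounds differ by one factor l *)
have lP : l `^ (1 - a) = l * P by rewrite mulr_powRB1// ltW.
have {}low : M * P / beta a <= f t0 by rewrite ler_pdivrMr// [f t0 * _]mulrC.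
pose A := M * P / beta a.
have A0 : 0 < A by rewrite divr_gt0// mulr_gt0.
have {}up t : tau <= t -> t <= t0 -> `|hadamard 1 f t| <= A * (l / (1 - a)).
  move=> tt1 tt2; have := up t tt1 tt2; rewrite lP normrM gtr0_norm//.
  by rewrite mulrC -ler_pdivlMr//; congr (_ <= _); rewrite /A; field; rewrite !lt0r_neq0.
have k1 : l / (1 - a) <= 1 / 8 by rewrite ler_pdivrMr// mul1r mulrC.
have := hadamard1_div_lower tau1 tt mf fC cf f0 up.
have r1 : (t0 - tau) / tau ^+ 2 <= t0^-1.
  rewrite ler_pdivrMr ?exprn_gt0// ler_pdivlMl// expr2.
  have d0 : 0 <= t0 - tau by lra.
  have d1 : t0 - tau <= tau / 2 by nra.
  have d2 : t0 <= 2 * tau by lra.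
  nra.
move: low; rewrite -/A.
have k0 : 0 <= l / (1 - a) by rewrite divr_ge0// ltW.
have up1 : A * (l / (1 - a)) / t0 <= A / t0 * (1 / 8).
  by rewrite mulrAC ler_wpM2l// divr_ge0// ltW.
have up2 : A * (l / (1 - a)) * ((t0 - tau) / tau ^+ 2) <= A / t0 * (1 / 8).
  apply: le_trans up1; rewrite ler_wpM2l// mulr_ge0// ltW//.
have A1 : 0 < A / t0 by rewrite divr_gt0.
move=> low; have {}low : A / t0 <= f t0 / t0 by rewrite ler_pM2r ?invr_gt0.
move: low up1 up2 A1; move: (hadamard 1 _ t0) (f t0 / t0) (A / t0).
move: (A * (l / (1 - a)) / t0) (A * (l / (1 - a)) * ((t0 - tau) / tau ^+ 2)).
move=> x1 x2 x3 x4 x5; clear.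
by lra.
Qed.

End VolterraPositivity.

(** * Derivatives relative to a set, and second differences *)

Section DeriveIn.
Context {R : realType}.
Implicit Types (A : set R) (f g : R -> R) (a b d e s t T : R).

(** The limit that defines [derivable_in] and [derive_in], with its value as a
    parameter, as in [is_derive]. *)
Definition is_derive_in A f t d : Prop :=
  (f s - f t) / (s - t) @[s --> within A t^'] --> d.

Lemma is_derive_is_derive_in A f t d :
  is_derive t 1 f d -> is_derive_in A f t d.
Proof. by move=> /is_derive_quotient; exact: cvg_within_filter. Qed.

Lemma eq_is_derive_in A f g t d : A t -> {in A, f =1 g} ->
  is_derive_in A f t d -> is_derive_in A g t d.
Proof.
move=> At fg; apply: cvg_near_eq; near=> s.
have As : A s by near: s; exact: withinT.
by rewrite !fg ?inE.
Unshelve. all: by end_near. Qed.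

Lemma is_derive_inD A f g t a b : is_derive_in A f t a ->
  is_derive_in A g t b -> is_derive_in A (fun s => f s + g s) t (a + b).
Proof.
move=> fa gb; apply: cvg_near_eq (cvgD fa gb); apply: nearW => s.
by rewrite /= -mulrDl opprD addrACA.
Qed.

Lemma is_derive_inZ A f t (k : R) a : is_derive_in A f t a ->
  is_derive_in A (fun s => k * f s) t (k * a).
Proof.
move=> fa; apply: cvg_near_eq (cvgM (cvg_cst k) fa); apply: nearW => s.
by rewrite /= mulrA mulrBr.
Qed.

Lemma is_derive_inB A f g t a b : is_derive_in A f t a ->
  is_derive_in A g t b -> is_derive_in A (fun s => f s - g s) t (a - b).
Proof.
move=> fa gb; have {}gb := @is_derive_inZ _ _ _ (-1) _ gb.
have := is_derive_inD fa gb.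
rewrite mulN1r => H; apply: cvg_near_eq H; apply: nearW => s.
by rewrite !mulN1r.
Qed.

Lemma is_derive_in_sum A (I : finType) (f : I -> R -> R) t (d : I -> R) :
  (forall i, is_derive_in A (f i) t (d i)) ->
  is_derive_in A (fun s => \sum_i f i s) t (\sum_i d i).
Proof.
move=> fd.
have : \sum_i ((f i s - f i t) / (s - t)) @[s --> within A t^'] --> \sum_i d i.
  by apply: cvg_big => [|i _]; [exact: add_continuous|exact: fd].
move=> H; apply: cvg_near_eq H; apply: nearW => s.
by rewrite -mulr_suml sumrB.
Qed.

Lemma is_derive_inM A f g t a b : {for t, continuous g} ->
  is_derive_in A f t a -> is_derive_in A g t b ->
  is_derive_in A (fun s => f s * g s) t (a * g t + f t * b).
Proof.
move=> cg fa gb.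
have cg' : g s @[s --> within A t^'] --> g t.
  by apply: cvg_within_filter; apply/continuous_withinNx.
apply: cvg_near_eq (cvgD (cvgM fa cg') (cvgM (cvg_cst (f t)) gb)).
apply: nearW => s.
change ((f s - f t) / (s - t) * g s + f t * ((g s - g t) / (s - t)) =
  (f s * g s - f t * g t) / (s - t)).
by ring.
Qed.

Lemma cvg_within_near A (F : set_system R) {FF : Filter F} (f : R -> R) (l : R) :
  (\forall s \near F, A s) -> f @ within A F --> l -> f @ F --> l.
Proof.
move=> FA fl; apply: cvg_trans fl; apply: cvg_app => P.
by rewrite /within/= => PA; apply: filterS2 FA PA => s As; apply.
Qed.

Lemma is_derive_in_interior a b f t d : a < t -> t < b ->
  is_derive_in `[a, b] f t d -> is_derive t 1 f d.
Proof.
move=> at_ tb fd; apply: quotient_is_derive; apply: cvg_within_near fd.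
near=> s; rewrite /= in_itv/=; apply/andP; split; apply: ltW; near: s.
  by apply: cvg_within; exact: lt_nbhsr.
by apply: cvg_within; exact: lt_nbhsl.
Unshelve. all: by end_near. Qed.

Lemma is_derive_in_left a b f t d : a < t -> t <= b ->
  is_derive_in `[a, b] f t d -> (f s - f t) / (s - t) @[s --> t^'-] --> d.
Proof.
move=> at_ tb fd.
have {fd} : (f s - f t) / (s - t) @[s --> within `[a, b] t^'-] --> d.
  apply: cvg_trans fd; apply: cvg_app => P.
  apply: (@filterS _ (nbhs t) _ (fun s => s != t -> `[a, b]%classic s -> P s)).
  by move=> s H st; apply: H; rewrite lt_eqF.
apply: cvg_within_near; near=> s.
have st : s < t by near: s; exact: nbhs_left_lt.
rewrite /= in_itv/=; apply/andP; split; last by rewrite (le_trans (ltW st)).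
by apply: ltW; near: s; exact: nbhs_left_gt.
Unshelve. all: by end_near. Qed.

Lemma quotient_left_continuous f t d :
  (f s - f t) / (s - t) @[s --> t^'-] --> d -> f s @[s --> t^'-] --> f t.
Proof.
move=> fd.
have H : s - t @[s --> t^'-] --> t - t.
  by apply: cvgB; [exact: cvg_at_left_filter cvg_id|exact: cvg_cst].
rewrite subrr in H.
have H1 : (f s - f t) / (s - t) * (s - t) + f t @[s --> t^'-] --> d * 0 + f t.
  by apply: cvgD; [exact: cvgM|exact: cvg_cst].
rewrite mulr0 add0r in H1.
apply: cvg_near_eq H1; near=> s; rewrite /= divfK ?subrK// subr_eq0 lt_eqF//.
Unshelve. all: by end_near. Qed.

Lemma is_derive_in_continuous a b f df t1 t2 : a < t1 -> t1 < t2 -> t2 <= b ->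
  (forall t, a < t -> t <= b -> is_derive_in `[a, b] f t (df t)) ->
  {within `[t1, t2], continuous f}.
Proof.
move=> at1 t12 t2b fd.
have cf t : a < t -> t < b -> {for t, continuous f}.
  move=> at_ tb; apply: (@is_derive_continuous _ _ _ (df t)).
  by apply: (is_derive_in_interior at_ tb); apply: fd => //; exact: ltW.
apply/(continuous_within_itvP _ t12); split.
- move=> t; rewrite in_itv/= => /andP[? ?]; apply: cf; first exact: lt_trans at1 _.
  exact: lt_le_trans t2b.
- by apply: cvg_at_right_filter; apply: cf => //; exact: lt_le_trans t2b.
- have at2 := lt_trans at1 t12.
  apply: (@quotient_left_continuous _ _ (df t2)).
  exact: (is_derive_in_left at2 t2b (fd _ at2 t2b)).
Qed.

(** The derivative may be one-sided at [b], where the mean value theorem only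
    needs continuity from the left. *)
Lemma is_derive_in_le a b f df t1 t2 K : a < t1 -> t1 < t2 -> t2 <= b ->
  (forall t, a < t -> t <= b -> is_derive_in `[a, b] f t (df t)) ->
  (forall t, t1 < t -> t < t2 -> df t <= K) ->
  f t2 - f t1 <= K * (t2 - t1).
Proof.
move=> at1 t12 t2b fd dK.
have df' t : t \in `]t1, t2[ -> is_derive t 1 f (df t).
  rewrite in_itv/= => /andP[t1t tt2].
  have at_ := lt_trans at1 t1t; have tb := lt_le_trans tt2 t2b.
  by apply: (is_derive_in_interior at_ tb); apply: fd => //; exact: ltW.
have [t tin ->] := MVT t12 df' (is_derive_in_continuous at1 t12 t2b fd).
move: tin; rewrite in_itv/= => /andP[? ?].
by rewrite ler_wpM2r ?dK// subr_ge0 ltW.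
Qed.

(** The mean value theorem, first for [f s - f (s - e)] and then for [f1]. *)
Lemma second_difference f f1 f2 e : 0 < e ->
  (forall s, - e <= s -> s <= e -> is_derive s 1 f (f1 s)) ->
  (forall s, - e <= s -> s <= e -> is_derive s 1 f1 (f2 s)) ->
  exists s, [/\ - e <= s, s <= e & f e + f (- e) - 2 * f 0 = e ^+ 2 * f2 s].
Proof.
move=> e0 df df1.
have shift (h : R -> R) dh s : is_derive (s - e) 1 h (dh (s - e)) ->
    is_derive s 1 (fun s => h (s - e)) (dh (s - e)).
  move=> H.
  have d1 : is_derive s 1 (fun s : R => s - e) 1.
    rewrite -[X in is_derive _ _ _ X]subr0.
    by apply: is_deriveB; exact: is_derive_cst.
  rewrite -[X in is_derive _ _ _ X]mulr1.
  exact: (@is_derive1_comp _ h (fun s => s - e) s _ _ H d1).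
pose g s := f s - f (s - e).
have dg s : s \in `]0, e[ -> is_derive s 1 g (f1 s - f1 (s - e)).
  rewrite in_itv/= => /andP[s0 se].
  by apply: is_deriveB; [apply: df|apply: shift; apply: df]; lra.
have cg : {within `[0, e], continuous g}.
  apply: continuous_in_subspaceT => s; rewrite inE/= in_itv/= => /andP[s0 se].
  apply: (@is_derive_continuous _ _ _ (f1 s - f1 (s - e))).
  by apply: is_deriveB; [apply: df|apply: shift; apply: df]; lra.
have [x xin gE] := MVT e0 dg cg.
move: xin; rewrite in_itv/= => /andP[x0 xe].
have df1' s : s \in `](x - e), x[ -> is_derive s 1 f1 (f2 s).
  by rewrite in_itv/= => /andP[? ?]; apply: df1; lra.
have cf1 : {within `[x - e, x], continuous f1}.
  apply: continuous_in_subspaceT => s; rewrite inE/= in_itv/= => /andP[s0 se].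
  by apply: (@is_derive_continuous _ _ _ (f2 s)); apply: df1; lra.
have xx : x - e < x by lra.
have [y yin f1E] := MVT xx df1' cf1.
move: yin; rewrite in_itv/= => /andP[y0 ye].
exists y; split; [lra|lra|].
move: gE; rewrite /g f1E subr0 subrr sub0r (_ : x - (x - e) = e); last by ring.
move=> H; have -> : e ^+ 2 * f2 y = f2 y * e * e by ring.
by rewrite -H; ring.
Qed.

End DeriveIn.

(** * The homogeneous problem and growth in time *)

Section HomogeneousProblem.
Context {R : realType} {n : nat}.
Implicit Types (x y : 'rV[R]_n) (e s t : R) (i j : 'I_n).

Lemma is_derive_line (f : 'rV[R]_n -> R) x (v : 'rV[R]_n) s (d : R) :
  is_derive (x + s *: v) v f d -> is_derive s 1 (fun s => f (x + s *: v)) d.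
Proof.
move=> [df Df].
have E : (fun h : R => h^-1 *: (f (x + (h *: 1 + s) *: v) - f (x + s *: v))) =
    (fun h : R => h^-1 *: (f (h *: v + (x + s *: v)) - f (x + s *: v))).
  apply/funext => h; congr (_ *: (f _ - _)).
  by rewrite /GRing.scale/= mulr1 -/(GRing.scale _ _) scalerDl addrCA.
split; first by rewrite /derivable E.
by rewrite /derive E.
Qed.

(** The properties of a difference [w] of two solutions on which the proof
    relies. Outside [[1, T]] the function [w x] is extended by constants, so that
    it is continuous on the real line; [g] is [c] times the Hadamard integral of
    [w], [z = t g_t] is the function to which the Laplacian is applied, and
    [q i] is its second derivative in the direction [i]. The field [hs_second]
    replaces the statement that [q i] is that derivative: a second difference
    quotient of [z] is a value of [q i] on the segment. *)
Record homogeneous_solution (alpha nu T c : R) (G : set 'rV[R]_n)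
    (w g z : 'rV[R]_n -> R -> R) (q : 'I_n -> 'rV[R]_n -> R -> R) : Prop := {
  hs_continuous : forall x, closure G x -> continuous (w x);
  hs_equicontinuous : forall x, closure G x -> forall e, 0 < e ->
    \forall y \near x, closure G y -> forall t, `|w y t - w x t| <= e;
  hs_bounded : exists C, forall x, closure G x -> forall t, `|w x t| <= C;
  hs_initial : forall x, closure G x -> forall t, t <= 1 -> w x t = 0;
  hs_boundary : forall x, boundary G x -> forall t, w x t = 0;
  hs_integral : forall x t, closure G x -> 1 <= t -> t <= T ->
    g x t = c * hadamard alpha (w x) t;
  hs_derive_g : forall x t, G x -> 1 < t -> t <= T ->
    is_derive_in `[1, T] (g x) t (z x t / t);
  hs_derive_w : forall x t, G x -> 1 < t -> t <= T ->
    is_derive_in `[1, T] (w x) t (nu * \sum_i q i x t);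
  hs_second : forall i x t e, 1 < t -> t <= T -> 0 < e ->
    (forall s, - e <= s -> s <= e -> G (x + s *: unit_vec R i)) ->
    exists s, [/\ - e <= s, s <= e &
      z (x + e *: unit_vec R i) t + z (x - e *: unit_vec R i) t - 2 * z x t =
      e ^+ 2 * q i (x + s *: unit_vec R i) t];
  hs_q : forall x t1, G x -> 1 < t1 -> forall e, 0 < e ->
    \forall y \near x, forall i t, t1 <= t -> t <= T ->
      `|q i y t - q i x t| <= e
}.

End HomogeneousProblem.

Section MaximumPrinciple.
Context {R : realType} {n : nat} (alpha nu T c : R) (G : set 'rV[R]_n)
  (w g z : 'rV[R]_n -> R -> R) (q : 'I_n -> 'rV[R]_n -> R -> R).
Hypotheses (G_open : open G) (nu0 : 0 < nu) (c0 : 0 <= c)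
  (alpha0 : 0 < alpha) (T1 : 1 < T).
Hypothesis wg : homogeneous_solution alpha nu T c G w g z q.
Implicit Types (x y : 'rV[R]_n) (e s t : R) (i j : 'I_n).

Lemma near_segment (P : set 'rV[R]_n) x : (\forall y \near x, P y) ->
  exists2 e, 0 < e & forall i e', 0 < e' -> e' <= e ->
    forall s, - e' <= s -> s <= e' -> P (x + s *: unit_vec R i).
Proof.
move=> /nbhs_ballP[e /= e0 xP]; exists (e / 2); first by rewrite divr_gt0.
move=> i e' e'0 e'e s es se; apply: xP; split => // a b.
rewrite /unit_vec !mxE -ball_normE/= opprD addrA subrr sub0r normrN normrM.
have sl : `|s| < e by rewrite ltr_norml; apply/andP; split; lra.
apply: le_lt_trans sl; rewrite ler_piMr// ger0_norm ?ler0n//.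
by case: (_ && _); rewrite ?ler01.
Qed.

(** The primitive in time of [w_t / t], integrated by parts. *)
Definition weighted x t := w x t / t + hadamard 1 (fun s => w x s / s) t.

Lemma is_derive_in_weighted x t : G x -> 1 < t -> t <= T ->
  is_derive_in `[1, T] (weighted x) t (nu * (\sum_i q i x t) / t).
Proof.
move=> Gx t1 tT; have cx : closure G x by exact: subset_closure.
have cw := hs_continuous wg cx.
have [C wC] := hs_bounded wg.
have t0 : t != 0 by rewrite lt0r_neq0//; lra.
have cV : {for t, continuous (fun s : R => s^-1)}.
  by apply: continuousV => //; exact: cvg_id.
have C0 : 0 <= C := le_trans (normr_ge0 _) (wC x cx 0).
have mw : measurable_fun [set: R] (w x) by exact: continuous_measurable_fun.
have dV : is_derive_in `[1, T] (fun s => s^-1) t (- t ^- 2).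
  apply: is_derive_is_derive_in.
  by rewrite -[X in is_derive _ _ _ X]mulr1; exact: is_deriveV.
have dE : is_derive_in `[1, T] (hadamard 1 (fun s => w x s / s)) t (w x t / t / t).
  apply: is_derive_is_derive_in.
  have tt : t < t + 1 by lra.
  apply: (@is_derive_hadamard1 _ _ _ _ C t1 tt).
  - apply: measurable_funTS; apply: measurable_funM => //.
    exact: measurable_invr.
  - move=> s; rewrite in_itv/= => /andP[s1 _]; rewrite normrM normfV.
    have s0 : 0 < s by lra.
    by rewrite (gtr0_norm s0) ler_pdivrMr// (le_trans (wC x cx s))// ler_peMr.
  - by apply: continuousM; [exact: cw|].
have := is_derive_inD (is_derive_inM cV (hs_derive_w wg Gx t1 tT) dV) dE.
suff -> : nu * (\sum_i q i x t) * t^-1 + w x t * (- t ^- 2) + w x t / t / t =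
  nu * (\sum_i q i x t) / t by [].
by field.
Qed.

(** For small [e] the function [Phi = weighted - nu D], where [D] is the sum over
    the directions of the second difference quotients of [g] with step [e], has
    a small derivative in time: [nu / t] times a sum of differences of values
    of [q i] at [x] and at points within [e] of [x]. So the growth of
    [weighted x] from [t1] to [t2] is at most [nu] times that of [D], up to an
    arbitrarily small error. *)
Lemma weighted_growth x t1 t2 d : G x -> 1 < t1 -> t1 < t2 -> t2 <= T ->
  (\forall e \near 0^'+, forall i,
    (g (x + e *: unit_vec R i) t2 - g (x + e *: unit_vec R i) t1) +
    (g (x - e *: unit_vec R i) t2 - g (x - e *: unit_vec R i) t1) -
    2 * (g x t2 - g x t1) <= d * e ^+ 2) ->
  weighted x t2 - weighted x t1 <= nu * (n%:R * d).
Proof.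
move=> Gx t11 t12 t2T gd; apply/ler_addgt0Pr => e e0.
(* n.+1 instead of n keeps the quotient meaningful in dimension 0 *)
pose k := e / (nu * n.+1%:R * (t2 - t1)).
have k0 : 0 < k by rewrite divr_gt0// !mulr_gt0// subr_gt0.
have [r1 r10 Gr] := near_segment (open_nbhs_nbhs (conj G_open Gx)).
have [r2 r20 qr] := near_segment (hs_q wg Gx t11 k0).
have [h [h0 hr1 hr2 gh]] : exists h, [/\ 0 < h, h <= r1, h <= r2 & forall i,
    (g (x + h *: unit_vec R i) t2 - g (x + h *: unit_vec R i) t1) +
    (g (x - h *: unit_vec R i) t2 - g (x - h *: unit_vec R i) t1) -
    2 * (g x t2 - g x t1) <= d * h ^+ 2].
  near (0 : R)^'+ => h; exists h; split.
  - by [].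
  - by near: h; exact: nbhs_right_le.
  - by near: h; exact: nbhs_right_le.
  - by near: h.
have Gh i s : - h <= s -> s <= h -> G (x + s *: unit_vec R i).
  by move=> ? ?; apply: (Gr i h).
pose D t := \sum_i ((g (x + h *: unit_vec R i) t + g (x - h *: unit_vec R i) t) -
  2 * g x t).
have Gp i : G (x + h *: unit_vec R i) by apply: Gh; lra.
have Gm i : G (x - h *: unit_vec R i) by rewrite -scaleNr; apply: Gh; lra.
pose dD t := \sum_i ((z (x + h *: unit_vec R i) t / t +
  z (x - h *: unit_vec R i) t / t) - 2 * (z x t / t)).
have DD t : 1 < t -> t <= T -> is_derive_in `[1, T] D t (dD t).
  move=> t_1 tT; apply: is_derive_in_sum => i; apply: is_derive_inB.
    by apply: is_derive_inD; exact: (hs_derive_g wg).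
  by apply: is_derive_inZ; exact: (hs_derive_g wg).
pose Phi t := weighted x t - nu / h ^+ 2 * D t.
pose dPhi t := nu * (\sum_i q i x t) / t - nu / h ^+ 2 * dD t.
have DPhi t : 1 < t -> t <= T -> is_derive_in `[1, T] Phi t (dPhi t).
  move=> t_1 tT; apply: is_derive_inB; first exact: is_derive_in_weighted.
  by apply: is_derive_inZ; exact: DD.
have dPhile t : t1 < t -> t < t2 -> dPhi t <= nu * (n%:R * k).
  move=> t1t tt2; have t_1 := lt_trans t11 t1t.
  have tT := le_trans (ltW tt2) t2T.
  have t0 : 0 < t by lra.
  rewrite /dPhi.
  have -> : nu * (\sum_i q i x t) / t - nu / h ^+ 2 * dD t =
      nu / t * \sum_i (q i x t - (z (x + h *: unit_vec R i) t +
      z (x - h *: unit_vec R i) t - 2 * z x t) / h ^+ 2).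
    have -> : dD t = (\sum_i (z (x + h *: unit_vec R i) t +
      z (x - h *: unit_vec R i) t - 2 * z x t)) / t.
      rewrite mulr_suml; apply: eq_bigr => i _.
      by field; rewrite lt0r_neq0.
    rewrite [in RHS]sumrB -[in RHS]mulr_suml.
    move: (\sum_i q i x t) (\sum_i _) => A B.
    by field; rewrite !lt0r_neq0.
  have S : \sum_i (q i x t - (z (x + h *: unit_vec R i) t +
      z (x - h *: unit_vec R i) t - 2 * z x t) / h ^+ 2) <= n%:R * k.
    have -> : n%:R * k = \sum_(i < n) k.
      by rewrite sumr_const card_ord mulr_natl.
    apply: ler_sum => i _.
    have [s [sh hs ->]] := hs_second wg t_1 tT h0 (Gh i).
    rewrite mulrAC divff ?mul1r ?expf_neq0 ?lt0r_neq0//.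
    have := qr i h h0 hr2 s sh hs i t (ltW t1t) tT.
    by rewrite distrC; apply: le_trans; exact: ler_norm.
  have nk0 : 0 <= n%:R * k by rewrite mulr_ge0// ltW.
  apply: (@le_trans _ _ (nu / t * (n%:R * k))).
    by rewrite ler_wpM2l// divr_ge0// ltW.
  by rewrite ler_wpM2r// ler_pdivrMr// ler_peMr ?ltW.
have := is_derive_in_le t11 t12 t2T DPhi dPhile; rewrite /Phi.
have dh : nu / h ^+ 2 * (D t2 - D t1) <= nu * (n%:R * d).
  rewrite mulrAC -mulrA ler_pM2l// ler_pdivrMr ?exprn_gt0//.
  have -> : n%:R * d * h ^+ 2 = \sum_(i < n) (d * h ^+ 2).
    by rewrite sumr_const card_ord -mulrA mulr_natl.
  rewrite /D -sumrB; apply: ler_sum => i _; apply: le_trans (gh i).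
  by rewrite le_eqVlt; apply/orP; left; apply/eqP; ring.
have kt : nu * (n%:R * k) * (t2 - t1) <= e.
  have -> : nu * (n%:R * k) * (t2 - t1) = e * (n%:R / n.+1%:R).
    have t21 : 0 < t2 - t1 by rewrite subr_gt0.
    have n1 : 0 < n.+1%:R :> R by [].
    rewrite /k; move: (t2 - t1) t21 (n.+1%:R : R) n1 => t' t'0 m m0.
    by field; rewrite !lt0r_neq0.
  by rewrite ger_pMr// ler_pdivrMr// mul1r ler_nat.
move=> H; rewrite mulrBr in dh.
rewrite -(lerD2r (- (nu / h ^+ 2 * D t2 - nu / h ^+ 2 * D t1))).
apply: (@le_trans _ _ e); last by rewrite -addrA addrCA lerDl subr_ge0.
apply: le_trans kt; apply: le_trans H.
move: (nu / h ^+ 2 * D t2) (nu / h ^+ 2 * D t1) => K2 K1.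
move: (weighted x t2) (weighted x t1) => W2 W1.
by rewrite le_eqVlt; apply/orP; left; apply/eqP; ring.
Unshelve. all: by end_near. Qed.

End MaximumPrinciple.

(** * The maximum principle in space *)

Section RealInequalities.
Context {R : realType}.
Implicit Types d k p e a b : R.

Lemma second_difference_le pp pm p dp dm d0 d k :
  dp + dm - 2 * d0 = 2 * k -> pp - d / 2 * dp <= p - d / 2 * d0 ->
  pm - d / 2 * dm <= p - d / 2 * d0 -> pp + pm - 2 * p <= d * k.
Proof.
move=> dE hp hm; have {dE}-> : k = (dp + dm - 2 * d0) / 2 by rewrite dE; field.
by lra.
Qed.

Lemma penalty_contradiction a b a1 b1 d : 0 < d -> a <= b ->
  `|a1| <= d / 8 -> `|b1| <= d / 8 -> b - b1 <= a - a1 - d / 2 -> False.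
Proof. by rewrite !ler_norml => d0 ab /andP[? ?] /andP[? ?] ?; lra. Qed.

Lemma le_of_four_quarters a b a1 b1 e : a - a1 <= e / 4 ->
  `|a - b| <= e / 4 -> `|a1 - b1| <= e / 4 -> `|b1| <= e / 4 -> b <= e.
Proof. by rewrite !ler_norml => ? /andP[? ?] /andP[? ?] /andP[? ?]; lra. Qed.

End RealInequalities.

Section InteriorMaximum.
Context {R : realType} {n : nat} (alpha nu T c : R) (G : set 'rV[R]_n)
  (w g z : 'rV[R]_n -> R -> R) (q : 'I_n -> 'rV[R]_n -> R -> R).
Hypotheses (G_open : open G) (nu0 : 0 < nu) (c0 : 0 <= c)
  (alpha0 : 0 < alpha) (T1 : 1 < T).
Hypothesis wg : homogeneous_solution alpha nu T c G w g z q.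
Implicit Types (x y : 'rV[R]_n) (e s t : R) (i j : 'I_n).

Let mw x : closure G x -> measurable_fun [set: R] (w x).
Proof. by move=> cx; apply: continuous_measurable_fun; exact: (hs_continuous wg). Qed.

Lemma mono_powR_ln (a s t : R) : 0 < a -> 1 <= s -> s <= t ->
  ln s `^ a / a <= ln t `^ a / a.
Proof.
move=> a0 s1 st; rewrite ler_pM2r ?invr_gt0//.
apply: ge0_ler_powR; rewrite ?nnegrE ?ln_ge0 ?(ltW a0)//; first exact: le_trans st.
by rewrite ler_ln ?posrE//; lra.
Qed.

(** The integral depends on [w y] through its values up to time [T] only, hence
    is continuous in space uniformly in time. *)
Lemma integral_close x y e t : closure G x -> closure G y -> 1 <= t -> t <= T ->
  (forall s, `|w y s - w x s| <= e) ->
  `|g y t - g x t| <= c * (e * (ln T `^ alpha / alpha)).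
Proof.
move=> cx cy t1 tT we; have [C wC] := hs_bounded wg.
rewrite !(hs_integral wg)// -mulrBr normrM (ger0_norm c0) ler_wpM2l//.
rewrite -(@hadamardB _ _ _ _ _ C)//; first last.
- by move=> s _; exact: wC.
- by apply: measurable_funTS; exact: mw.
- by move=> s _; exact: wC.
- by apply: measurable_funTS; exact: mw.
apply: (@le_trans _ _ (e * (ln t `^ alpha / alpha))).
  apply: norm_hadamard_le => //.
  by apply: measurable_funTS; apply: measurable_funB; exact: mw.
by rewrite ler_wpM2l ?mono_powR_ln// (le_trans _ (we 0)).
Qed.

Lemma integral_small C x t : (forall x, closure G x -> forall t, `|w x t| <= C) ->
  closure G x -> 1 <= t -> t <= T ->
  `|g x t| <= c * (C * (ln t `^ alpha / alpha)).
Proof.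
move=> wC cx t1 tT.
rewrite (hs_integral wg)// normrM (ger0_norm c0) ler_wpM2l//.
apply: norm_hadamard_le => //; first by apply: measurable_funTS; exact: mw.
by move=> s _; exact: wC.
Qed.

Lemma hadamard1_div_bound (f : R -> R) (K t : R) : 1 <= t ->
  measurable_fun [set: R] f -> (forall s, `|f s| <= K) ->
  `|hadamard 1 (fun s => f s / s) t| <= K * ln t.
Proof.
move=> t1 mf fK; have -> : ln t = ln t `^ 1 / 1.
  by rewrite divr1 powRr1// ln_ge0.
apply: norm_hadamard_le => //.
  apply: measurable_funTS; apply: measurable_funM => //; exact: measurable_invr.
move=> s; rewrite in_itv/= => /andP[s1 _]; have s0 : 0 < s by lra.
have K0 : 0 <= K := le_trans (normr_ge0 _) (fK 0).
by rewrite normrM normfV (gtr0_norm s0) ler_pdivrMr// (le_trans (fK s))// ler_peMr.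
Qed.

Lemma weighted_close x y e t : closure G x -> closure G y -> 1 <= t -> t <= T ->
  (forall s, `|w y s - w x s| <= e) ->
  `|weighted w y t - weighted w x t| <= e * (1 + ln T).
Proof.
move=> cx cy t1 tT we; have [C wC] := hs_bounded wg.
have C0 : 0 <= C := le_trans (normr_ge0 _) (wC x cx 0).
have e0 : 0 <= e := le_trans (normr_ge0 _) (we 0).
have t0 : 0 < t by lra.
have bd x' : closure G x' -> {in `[1, t], forall s, `|w x' s / s| <= C}.
  move=> cx' s; rewrite in_itv/= => /andP[s1 _]; have s0 : 0 < s by lra.
  rewrite normrM normfV (gtr0_norm s0) ler_pdivrMr//.
  by rewrite (le_trans (wC x' cx' s))// ler_peMr.
have mb x' : closure G x' -> measurable_fun `[1, t] (fun s => w x' s / s).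
  move=> cx'; apply: measurable_funTS; apply: measurable_funM; first exact: mw.
  exact: measurable_invr.
have -> : weighted w y t - weighted w x t = (w y t - w x t) / t +
    hadamard 1 (fun s => (w y s - w x s) / s) t.
  rewrite /weighted opprD addrACA -mulrBl; congr (_ + _).
  rewrite -(@hadamardB _ 1 _ _ t C ltr01 (mb y cy) (bd y cy) (mb x cx) (bd x cx)).
  by apply: eq_hadamard => s _; rewrite mulrBl.
rewrite (le_trans (ler_normD _ _))// mulrDr mulr1; apply: lerD.
  rewrite normrM normfV (gtr0_norm t0) ler_pdivrMr// (le_trans (we t))//.
  by rewrite ler_peMr.
apply: (@le_trans _ _ (e * ln t)).
  by apply: hadamard1_div_bound => //; apply: measurable_funB; exact: mw.
by rewrite ler_wpM2l// ler_ln ?posrE//; lra.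
Qed.

Lemma weighted_small C x t : closure G x -> (forall s, `|w x s| <= C) ->
  1 <= t -> `|weighted w x t| <= `|w x t| + C * ln t.
Proof.
move=> cx wC t1; have t0 : 0 < t by lra.
rewrite (le_trans (ler_normD _ _))//; apply: lerD; last first.
  by apply: hadamard1_div_bound => //; exact: mw.
by rewrite normrM normfV (gtr0_norm t0) ler_pdivrMr// ler_peMr.
Qed.

Lemma continuous_integral x t : G x -> 1 <= t -> t <= T ->
  {for x, continuous (g ^~ t)}.
Proof.
move=> Gx t1 tT; have cx : closure G x by exact: subset_closure.
apply/(@cvgrPdist_le _ _ _ (nbhs x)) => e e0.
pose k := c * (ln T `^ alpha / alpha) + 1.
have k0 : 0 < k.
  by rewrite ltr_wpDl// mulr_ge0// divr_ge0 ?powR_ge0// ltW.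
have ek0 : 0 < e / k by rewrite divr_gt0.
have H := hs_equicontinuous wg cx ek0.
have nG : nbhs x G by exact: open_nbhs_nbhs.
apply: (@filterS2 _ (nbhs x) _ _ _ _ _ nG H) => y Gy wy; rewrite distrC.
have cy : closure G y by exact: subset_closure.
apply: (@le_trans _ _ (c * (e / k * (ln T `^ alpha / alpha)))).
  by apply: integral_close => //; exact: wy.
rewrite mulrCA -[leRHS](divfK (lt0r_neq0 k0)) ler_wpM2l//; first exact: ltW.
by rewrite /k lerDl.
Qed.

Definition dist2 x y : R := \sum_i (y ord0 i - x ord0 i) ^+ 2.

Lemma dist2_second_difference x y i e :
  dist2 x (y + e *: unit_vec R i) + dist2 x (y - e *: unit_vec R i) -
    2 * dist2 x y = 2 * e ^+ 2.
Proof.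
rewrite /dist2 -big_split/= mulr_sumr -sumrB (bigD1 i)//= big1 => [|j ji].
  by rewrite !mxE !eqxx/= mulr1; ring.
by rewrite !mxE (negbTE ji) andbF /= mulr0; ring.
Qed.

Lemma continuous_dist2 x : continuous (dist2 x).
Proof.
move=> y; apply: (@cvg_big R _ _ _ _ add_continuous _ (nbhs y)) => i _.
have c1 : y' ord0 i @[y' --> nbhs y] --> y ord0 i.
  exact: (@coord_continuous R 1 n ord0 i y).
have c2 : y' ord0 i - x ord0 i @[y' --> nbhs y] --> y ord0 i - x ord0 i.
  by apply: cvgB => //; exact: cvg_cst.
exact: (cvg_comp _ _ c2 (@exprn_continuous R 2 (y ord0 i - x ord0 i))).
Qed.

Lemma cvg_powR_ln1 (a : R) : 0 < a -> ln t `^ a @[t --> 1^'+] --> 0.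
Proof.
move=> a0.
apply: (@increasing_cvg_at_right_comp R (@ln R) (@powR R ^~ a) 1 (BRight 2)).
- by rewrite bnd_simp; lra.
- move=> x y; rewrite !in_itv/= => /andP[? _] /andP[? _] xy.
  by rewrite ltr_ln ?posrE//; lra.
- by apply: cvg_at_right_filter; exact: continuous_ln.
- by rewrite ln1; exact: powR_cvg0.
Qed.

(** On a small cube around [x] maximize
    [g y t0 - g y t1 - (d / 2) * dist2 x y]. If [t1] is close enough to 1, then
    [g y t1] is so small that the penalty keeps the maximum point [ys] off the
    faces of the cube, and [weighted_growth] at [ys] bounds
    [weighted ys t0 - weighted ys t1] by [nu n d]. By equicontinuity the first
    term is close to [weighted x t0] and the second one to [weighted x t1],
    which tends to 0 with [t1 - 1]. Each of the four errors is at most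
    [e / 4]. *)
Lemma maximum_weighted_le0 x t0 : G x -> 1 < t0 -> t0 <= T ->
  (forall y, closure G y -> g y t0 <= g x t0) -> weighted w x t0 <= 0.
Proof.
move=> Gx t01 t0T gmax; apply/ler_addgt0Pr => e e0; rewrite add0r.
have cx : closure G x by exact: subset_closure.
have [C wC] := hs_bounded wg.
pose m := 1 + ln T.
have m0 : 0 < m by rewrite /m ltr_pwDl// ln_ge0// ltW.
pose e1 := e / 4 / m.
have e10 : 0 < e1 by rewrite !divr_gt0.
have : \forall y \near x,
    G y /\ (closure G y -> forall t, `|w y t - w x t| <= e1).
  have nG : nbhs x G by exact: open_nbhs_nbhs.
  apply: (@filterS2 _ (nbhs x) _ _ _ _ _ nG (hs_equicontinuous wg cx e10)).
  by move=> y Gy wy; split; [exact: Gy|exact: wy].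
move=> /nbhs_ballP[r0 /= r00 xr0].
pose r := r0 / 2.
have r_gt0 : 0 < r by rewrite divr_gt0.
have rr0 : r < r0 by rewrite /r; lra.
clearbody r.
pose Cube : set 'rV[R]_n :=
  [set y | forall i, `[x ord0 i - r, x ord0 i + r]%classic (y ord0 i)].
have subC y : Cube y -> G y /\ forall t, `|w y t - w x t| <= e1.
  move=> Cy; have [|Gy H] := xr0 y.
    split => // i j; rewrite ord1 -ball_normE/=.
    have := Cy j; rewrite /= in_itv/= => /andP[? ?].
    by rewrite ltr_norml; apply/andP; split; lra.
  by split => // t; apply: H; exact: subset_closure.
have Cx : Cube x by move=> i; rewrite /= in_itv/=; apply/andP; split; lra.
have ballC y : ball x r y -> Cube y.
  move=> [_ xy] i; have := xy ord0 i; rewrite -ball_normE/= ltr_norml => /andP[? ?].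
  by rewrite /= in_itv/=; apply/andP; split; lra.
have compC : compact Cube.
  exact: (@rV_compact _ _ (fun i => `[x ord0 i - r, x ord0 i + r]%classic)
    (fun i => @segment_compact _ _ _)).
pose d := e / 4 / (nu * n.+1%:R).
have d0 : 0 < d by rewrite !divr_gt0// mulr_gt0.
(* a quarter of the penalty (d / 2) r^2 paid on the faces of the cube *)
pose eta := d * r ^+ 2 / 8.
have eta0 : 0 < eta by rewrite divr_gt0// mulr_gt0// exprn_gt0.
have [t1 [t11 t10 gt1 wt1]] : exists t1, [/\ 1 < t1, t1 < t0,
    forall y, closure G y -> `|g y t1| <= eta & `|weighted w x t1| <= e / 4].
  have L1 : c * (C * (ln t `^ alpha / alpha)) @[t --> 1^'+] -->
      c * (C * (0 / alpha)).
    apply: cvgM; first exact: cvg_cst.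
    apply: cvgM; first exact: cvg_cst.
    by apply: cvgM; [exact: cvg_powR_ln1|exact: cvg_cst].
  have L2 : `|w x t| + C * ln t @[t --> (1 : R)^'+] --> `|w x 1| + C * ln 1.
    apply: cvgD.
      by apply: cvg_norm; apply: cvg_at_right_filter; exact: (hs_continuous wg).
    apply: cvgM; first exact: cvg_cst.
    by apply: cvg_at_right_filter; exact: continuous_ln.
  rewrite mul0r !mulr0 in L1.
  rewrite ln1 mulr0 (hs_initial wg)// normr0 addr0 in L2.
  near (1 : R)^'+ => t1; exists t1.
  have t11 : 1 < t1 by [].
  have t1t : t1 < t0 by near: t1; exact: nbhs_right_lt.
  split => //.
    move=> y cy; apply: (le_trans (integral_small wC cy (ltW t11) _)).
      by rewrite (le_trans (ltW t1t)).
    by near: t1; apply: (cvgr_le 0).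
  apply: (le_trans (weighted_small cx (wC x cx) (ltW t11))).
  by near: t1; apply: (cvgr_le 0) => //; rewrite divr_gt0.
have t1T : t1 <= T by rewrite (le_trans (ltW t10)).
pose P y := g y t0 - g y t1 - d / 2 * dist2 x y.
have cP y : Cube y -> {for y, continuous P}.
  move=> /subC[Gy _].
  have k0 : g y' t0 @[y' --> nbhs y] --> g y t0.
    by apply: continuous_integral => //; exact: ltW.
  have k1 : g y' t1 @[y' --> nbhs y] --> g y t1.
    by apply: continuous_integral => //; exact: ltW.
  have k2 : d / 2 * dist2 x y' @[y' --> nbhs y] --> d / 2 * dist2 x y.
    by apply: cvgM; [exact: cvg_cst|exact: continuous_dist2].
  exact: (cvgB (cvgB k0 k1) k2).
have [ys ysC ysmax] : exists2 y, Cube y & forall y', Cube y' -> P y' <= P y.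
  have := @compact_EVT_max _ R P Cube (ex_intro _ x Cx) compC.
  case; first by apply: continuous_in_subspaceT => y; rewrite inE; exact: cP.
  move=> y; rewrite inE => Cy H; exists y => // y' Cy'.
  by apply: H; rewrite inE.
have [Gys wys] := subC _ ysC.
have cys : closure G ys by exact: subset_closure.
have dys : dist2 x ys < r ^+ 2.
  rewrite ltNge; apply/negP => dr.
  have H1 := ysmax x Cx.
  have H2 : g ys t0 - g ys t1 - d / 2 * r ^+ 2 >= P ys.
    by rewrite /P lerD2l lerN2 ler_wpM2l// divr_ge0// ltW.
  have H3 : dist2 x x = 0.
    by rewrite /dist2 big1// => i _; rewrite subrr expr0n.
  have := le_trans H1 H2; rewrite /P H3 mulr0 subr0.
  have := gt1 x cx; have := gt1 ys cys; have := gmax ys cys.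
  move=> h1 h2 h3 h4; apply: (penalty_contradiction _ h1 h2 h3).
    by rewrite mulr_gt0// exprn_gt0.
  by rewrite mulrAC.
have ballys : ball x r ys.
  split => // i j; rewrite ord1 -ball_normE/= distrC -ltr_sqr ?nnegrE ?(ltW r_gt0)//.
  rewrite real_normK ?num_real//; apply: le_lt_trans dys.
  by rewrite /dist2 (bigD1 j)//= lerDl sumr_ge0// => k _; exact: sqr_ge0.
(* ys is interior, so that small steps in all directions stay in the cube *)
have nys : \forall y \near ys, Cube y.
  have := open_nbhs_nbhs (conj (ball_open x r) ballys).
  by apply: filterS => y; exact: ballC.
have [e2 e20 segC] := near_segment nys.
have grow := weighted_growth (d := d) G_open nu0 wg Gys t11 t10 t0T.
have {}grow : weighted w ys t0 - weighted w ys t1 <= nu * (n%:R * d).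
  apply: grow; near=> h => i.
  have h0 : 0 < h by [].
  have he2 : h <= e2 by near: h; exact: nbhs_right_le.
  have Cp : Cube (ys + h *: unit_vec R i).
    by apply: (segC i h) => //; lra.
  have Cm : Cube (ys - h *: unit_vec R i).
    by rewrite -scaleNr; apply: (segC i h) => //; lra.
  have := ysmax _ Cp; have := ysmax _ Cm; rewrite /P.
  move=> hm hp.
  exact: second_difference_le (dist2_second_difference x ys i h) hp hm.
have nd : nu * (n%:R * d) <= e / 4.
  have -> : nu * (n%:R * d) = e / 4 * (n%:R / n.+1%:R).
    have n1 : 0 < n.+1%:R :> R by [].
    by rewrite /d; move: (n.+1%:R : R) n1 => m' m'0; field; rewrite !lt0r_neq0.
  by rewrite ger_pMr ?divr_gt0// ler_pdivrMr// mul1r ler_nat.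
have c1 : `|weighted w ys t0 - weighted w x t0| <= e / 4.
  have -> : e / 4 = e1 * m by rewrite /e1 divfK// lt0r_neq0.
  by apply: weighted_close => //; exact: ltW.
have c2 : `|weighted w ys t1 - weighted w x t1| <= e / 4.
  have -> : e / 4 = e1 * m by rewrite /e1 divfK// lt0r_neq0.
  by apply: weighted_close => //; exact: ltW.
have {}grow := le_trans grow nd.
exact: le_of_four_quarters grow c1 c2 wt1.
Unshelve. all: by end_near. Qed.

End InteriorMaximum.

(** * Vanishing of the homogeneous solution *)

Section Uniqueness.
Context {R : realType} {n : nat} (alpha nu T c : R) (G : set 'rV[R]_n).
Hypotheses (G_open : open G) (nu0 : 0 < nu) (c0 : 0 <= c)
  (alpha0 : 0 < alpha) (alpha1 : alpha < 1) (T1 : 1 < T).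
Hypothesis (G_bounded : bounded_set G).
Implicit Types (x y : 'rV[R]_n) (e s t : R) (i j : 'I_n).

Lemma closure_boundary x : closure G x -> G x \/ boundary G x.
Proof.
move=> cx; have [Gx|Gx] := pselect (G x); first by left.
by right; split => // /interior_subset.
Qed.

Lemma compact_closure : compact (closure G).
Proof.
apply: bounded_closed_compact; last exact: closed_closure.
have [M [Mreal GM]] := G_bounded.
exists (`|M| + 2); split; first exact: num_real.
move=> N MN x /= cx.
have [y [Gy xy]] := cx _ (nbhsx_ballx x (1 : R) ltr01).
have yM : `|y| <= `|M| + 1 by apply: GM => //; rewrite (le_lt_trans (ler_norm M))// ltrDl.
rewrite -[x](subrK y) (le_trans (ler_normD _ _))//.
move: xy; rewrite -ball_normE/= => xy.
by by move: (`|x - y|) (`|y|) (`|M|) xy yM MN => a b m *; lra.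
Qed.

Section Solution.
Variables (w g z : 'rV[R]_n -> R -> R) (q : 'I_n -> 'rV[R]_n -> R -> R).
Hypothesis wg : homogeneous_solution alpha nu T c G w g z q.

Lemma integral_boundary0 x t : boundary G x -> 1 <= t -> t <= T -> g x t = 0.
Proof.
move=> bx t1 tT; rewrite (hs_integral wg)//; last by case: bx.
rewrite (@hadamard_vanish _ _ _ t)// ?mulr0// => s _.
exact: (hs_boundary wg).
Qed.

Lemma integral_vanish tau x t : closure G x -> {in `[1, tau], forall s, w x s = 0} ->
  1 <= t -> t <= T -> t <= tau -> g x t = 0.
Proof.
by move=> cx w0 t1 tT tt; rewrite (hs_integral wg)// (hadamard_vanish _ w0 tt) mulr0.
Qed.

(** Differentiability in time at the single time [t] gives the one-sided
    Lipschitz bound that [hadamard_extremum] asks for. *)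
Lemma left_lipschitz x t : G x -> 1 < t -> t <= T -> exists e K,
  [/\ 0 < e, 0 <= K & forall s, t - e < s -> s < t -> g x t - g x s <= K * (t - s)].
Proof.
move=> Gx t1 tT; have := is_derive_in_left t1 tT (hs_derive_g wg Gx t1 tT).
set d := z x t / t => gd.
have K0 : 0 < `|d| + 1 by rewrite ltr_wpDl.
have dK : d < `|d| + 1 by rewrite (le_lt_trans (ler_norm d))// ltrDl.
have H : \forall s \near t, s < t -> (g x s - g x t) / (s - t) <= `|d| + 1.
  exact: (cvgr_le d gd _ dK).
move/nbhs_ballP : H => [e /= e0 eK]; exists e, (`|d| + 1); split; [exact: e0|exact: ltW|].
move=> s es st.
have := eK s; rewrite -ball_normE/= gtr0_norm ?subr_gt0//.
have -> : (g x s - g x t) / (s - t) = (g x t - g x s) / (t - s).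
  by rewrite -(opprB (g x t)) -(opprB t s) invrN mulrNN.
rewrite ler_pdivrMr ?subr_gt0//; apply => //.
by rewrite ltrBlDl -ltrBlDr.
Qed.

(** The signs of [weighted w x t0] given by [maximum_weighted_le0] and by
    [hadamard_volterra_gt0] contradict each other. *)
Lemma no_positive_maximum tau x t0 : 0 < c -> 1 <= tau ->
  (forall y, closure G y -> {in `[1, tau], forall s, w y s = 0}) ->
  closure G x -> tau < t0 -> t0 <= T -> t0 <= (1 + (1 - alpha) / 8) * tau ->
  (forall y t, closure G y -> 1 <= t -> t <= t0 -> `|g y t| <= g x t0) ->
  0 < g x t0 -> False.
Proof.
move=> cp tau1 w0 cx tt t0T tq gmax g0.
have t01 : 1 < t0 by exact: le_lt_trans tt.
have [Gx|bx] := closure_boundary cx; last first.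
  by move: g0; rewrite integral_boundary0 ?ltxx// ltW.
have le0 : weighted w x t0 <= 0.
  apply: (maximum_weighted_le0 G_open nu0 c0 alpha0 T1 wg Gx t01 t0T) => y cy.
  by apply: (le_trans (ler_norm _)); apply: gmax => //; exact: ltW.
have [e [K [e0 K0 gK]]] := left_lipschitz Gx t01 t0T.
have [C wC] := hs_bounded wg.
have gE t : 1 <= t -> t <= T -> hadamard alpha (w x) t = g x t / c.
  by move=> t1 tT; rewrite (hs_integral wg)// mulrAC divff ?mul1r// lt0r_neq0.
(* hadamard_volterra_gt0 compares g at t0 with g at times after t0 - e',
   which must lie in [1, T] *)
pose e' := Num.min e (t0 - 1).
have e'0 : 0 < e' by rewrite lt_min e0 subr_gt0.
move: le0; rewrite leNgt => /negP; apply.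
apply: (@hadamard_volterra_gt0 _ alpha tau t0 C (K / c) (g x t0 / c) e') => //.
- by move=> s; exact: wC.
- exact: (hs_continuous wg).
- exact: w0.
- move=> s; rewrite in_itv/= => /andP[s1 st].
  rewrite gE//; last exact: le_trans t0T.
  rewrite normrM normfV (gtr0_norm cp) ler_pM2r ?invr_gt0//.
  exact: gmax.
- by rewrite gE// ltW.
- by rewrite divr_gt0.
- by rewrite divr_ge0.
- move=> s es st.
  have s1 : 1 <= s.
    have : e' <= t0 - 1 by rewrite /e' ge_min lexx orbT.
    by move: (e') es => e'' *; lra.
  have es' : t0 - e < s.
    have : e' <= e by rewrite /e' ge_min lexx.
    by move: (e') es => e'' *; lra.
  rewrite gE//; last by rewrite (le_trans (ltW st)).
  by rewrite -mulrBl mulrAC ler_pM2r ?invr_gt0// gK.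
Qed.

(** Second differences of [z] around [x] vanish, so that [q i] vanishes at points
    arbitrarily close to [x]. *)
Lemma second_vanish x t i : G x -> 1 < t -> t <= T ->
  (forall y, G y -> z y t = 0) -> q i x t = 0.
Proof.
move=> Gx t1 tT z0; apply/eqP; rewrite -normr_eq0 eq_le normr_ge0 andbT.
apply/ler_addgt0Pr => e e0; rewrite add0r.
have [r1 r10 Gr] := near_segment (open_nbhs_nbhs (conj G_open Gx)).
have [r2 r20 qr] := near_segment (hs_q wg Gx t1 e0).
pose h := Num.min r1 r2.
have h0 : 0 < h by rewrite lt_min r10.
have hr1 : h <= r1 by rewrite ge_min lexx.
have hr2 : h <= r2 by rewrite ge_min lexx orbT.
clearbody h.
have Gh s : - h <= s -> s <= h -> G (x + s *: unit_vec R i).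
  by move=> ? ?; apply: (Gr i h).
have [s [hs sh]] := hs_second wg t1 tT h0 Gh.
rewrite !z0//; last 2 first.
- by rewrite -scaleNr; apply: Gh; lra.
- by apply: Gh; lra.
rewrite addr0 mulr0 subr0 => /esym/eqP; rewrite mulf_eq0 expf_eq0/= (gt_eqF h0)/=.
move=> /eqP q0; have := qr i h h0 hr2 s hs sh i t (lexx t) tT.
by rewrite q0 sub0r normrN.
Qed.

(** Where [g = 0], also [z = t g_t = 0], and the equation reduces to
    [w_t = 0]. *)
Lemma solution_vanish T' : T' <= T ->
  (forall x t, closure G x -> 1 <= t -> t <= T' -> g x t = 0) ->
  forall x t, closure G x -> t <= T' -> w x t = 0.
Proof.
move=> TT g0 x t cx tT'.
have [t1|t1] := leP t 1; first exact: (hs_initial wg).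
have [Gx|bx] := closure_boundary cx; last exact: (hs_boundary wg).
have z0 y s : G y -> 1 < s -> s < T' -> z y s = 0.
  move=> Gy s1 sT.
  have sT' : s < T by exact: lt_le_trans TT.
  have d1 := is_derive_in_interior s1 sT' (hs_derive_g wg Gy s1 (ltW sT')).
  have d0 : is_derive s 1 (g y) 0.
    apply: near_eq_is_derive (is_derive_cst (0 : R) s 1) => //.
    near=> r; apply/esym/g0; first exact: subset_closure.
      by apply: ltW; near: r; exact: lt_nbhsr.
    by apply: ltW; near: r; exact: lt_nbhsl.
  have := @derive_val _ _ _ _ _ _ _ d1; rewrite (@derive_val _ _ _ _ _ _ _ d0).
  move/esym/eqP; rewrite mulf_eq0 invr_eq0 => /orP[/eqP//|/eqP s0].
  by move: s1; rewrite s0 ltNge ler01.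
have dw s : s \in `]1, t[ -> is_derive s 1 (w x) 0.
  rewrite in_itv/= => /andP[s1 st].
  have sT' : s < T' by exact: lt_le_trans tT'.
  have sT : s < T by exact: lt_le_trans TT.
  have d1 := is_derive_in_interior s1 sT (hs_derive_w wg Gx s1 (ltW sT)).
  suff -> : 0 = nu * \sum_i q i x s by exact: d1.
  rewrite big1 ?mulr0// => i _.
  apply: second_vanish => //; first exact: ltW.
  by move=> y Gy; exact: z0.
have cw : {within `[1, t], continuous (w x)}.
  by apply: continuous_subspaceT; exact: (hs_continuous wg).
have [s _] := MVT t1 dw cw.
by rewrite mul0r (hs_initial wg cx (lexx 1)) subr0.
Unshelve. all: by end_near. Qed.

(** Continuity at [t0 > 1] is a consequence of differentiability; at [t0 = 1] it
    follows from the bound by a multiple of [(ln t)^alpha]. *)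
Lemma continuous_integral_time x t0 : closure G x -> 1 <= t0 -> t0 <= T ->
  forall e, 0 < e -> \forall t \near t0, 1 <= t -> t <= T ->
    `|g x t - g x t0| <= e.
Proof.
move=> cx t01 t0T e e0.
have [Gx|bx] := closure_boundary cx; last first.
  apply: (@filterS _ (nbhs t0) _ setT) filterT => t _ t1 tT.
  rewrite !integral_boundary0// subrr normr0.
  exact: ltW.
move: t01; rewrite le_eqVlt => /predU1P[<-|t01].
  have [C wC] := hs_bounded wg.
  have L1 : c * (C * (ln t `^ alpha / alpha)) @[t --> 1^'+] -->
      c * (C * (0 / alpha)).
    apply: cvgM; first exact: cvg_cst.
    apply: cvgM; first exact: cvg_cst.
    by apply: cvgM; [exact: cvg_powR_ln1|exact: cvg_cst].
  rewrite mul0r !mulr0 in L1.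
  have H1 : \forall t \near (1 : R), 1 < t ->
      c * (C * (ln t `^ alpha / alpha)) <= e by exact: (cvgr_le 0 L1 _ e0).
  apply: (@filterS _ (nbhs (1 : R)) _ _ _ _ H1) => t H t1 tT.
  have g1 : g x 1 = 0.
    apply: (@integral_vanish 1) => // [s|]; last exact: ltW.
    by rewrite in_itv/= => /andP[_]; exact: (hs_initial wg).
  rewrite g1 subr0; move: t1; rewrite le_eqVlt => /predU1P[<-|t1].
    by rewrite g1 normr0 ltW.
  by apply: (le_trans (integral_small c0 alpha0 wg wC cx (ltW t1) tT)); exact: H.
have gd := hs_derive_g wg Gx t01 t0T; set d := z x t0 / t0 in gd.
have {}gd : (g x s - g x t0) / (s - t0) @[s --> within `[1, T] t0^'] --> d.
  exact: gd.
(* the difference quotients are bounded near t0 by |d| + 1 *)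
have H1 := @cvgr_dist_le _ _ _ _ _ _ _ gd _ ltr01.
have {}H1 : \forall t \near t0, t != t0 -> `[1, T]%classic t ->
    `|d - (g x t - g x t0) / (t - t0)| <= 1.
  exact: H1.
have K0 : 0 < `|d| + 1 by rewrite ltr_wpDl.
have H2 : \forall t \near t0, `|t0 - t| <= e / (`|d| + 1).
  apply/nbhs_ballP; exists (e / (`|d| + 1)); first by rewrite /= divr_gt0.
  by move=> t; rewrite -ball_normE/= => /ltW.
apply: (@filterS2 _ (nbhs t0) _ _ _ _ _ H1 H2) => t {}H1 {}H2 t1 tT.
have [->|tt] := eqVneq t t0; first by rewrite subrr normr0 ltW.
have tt0 : 0 < `|t - t0| by rewrite normr_gt0 subr_eq0.
have {}H1 : `|(g x t - g x t0) / (t - t0)| <= `|d| + 1.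
  have := H1 tt; rewrite /= in_itv/= t1 tT => /(_ isT).
  rewrite -[X in _ -> `|X| <= _](subrK d) distrC => H.
  by rewrite (le_trans (ler_normD _ _))// addrC lerD2l.
rewrite normrM normfV ler_pdivrMr// in H1; apply: (le_trans H1).
by rewrite -ler_pdivlMl// mulrC distrC.
Qed.

Lemma continuous_integral_joint T' : T' <= T ->
  {within closure G `*` `[1, T'], continuous (fun p : 'rV[R]_n * R => `|g p.1 p.2|)}.
Proof.
move=> TT; apply/subspace_continuousP => -[x0 t0] [/= cx0].
rewrite in_itv/= => /andP[t01 t0T'].
have t0T := le_trans t0T' TT.
apply/cvgrPdist_le => e e0.
pose k := c * (ln T `^ alpha / alpha) + 1.
have k0 : 0 < k.
  by rewrite ltr_wpDl// mulr_ge0// divr_ge0 ?powR_ge0// ltW.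
have e2 : 0 < e / 2 by rewrite divr_gt0.
have H1 := hs_equicontinuous wg cx0 (divr_gt0 e2 k0).
have H2 := continuous_integral_time cx0 t01 t0T e2.
rewrite near_withinE.
have : \forall p \near (x0, t0),
    (closure G p.1 -> forall t, `|w p.1 t - w x0 t| <= e / 2 / k) /\
    (1 <= p.2 -> p.2 <= T -> `|g x0 p.2 - g x0 t0| <= e / 2).
  exists ([set y | closure G y -> forall t, `|w y t - w x0 t| <= e / 2 / k],
          [set t | 1 <= t -> t <= T -> `|g x0 t - g x0 t0| <= e / 2]) => //.
apply: filterS => -[y t] /= [wy gt] [/= cy]; rewrite in_itv/= => /andP[t1 tT'].
have tT := le_trans tT' TT.
rewrite (le_trans (ler_dist_dist _ _))// distrC -(subrKA (g x0 t)).
rewrite (le_trans (ler_normD _ _))// [leRHS](splitr e) lerD ?gt//.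
apply: (@le_trans _ _ (c * (e / 2 / k * (ln T `^ alpha / alpha)))).
  by apply: (integral_close c0 alpha0 wg) => //; exact: wy.
rewrite mulrCA -[leRHS](divfK (lt0r_neq0 k0)) ler_wpM2l//.
  by rewrite ltW// divr_gt0.
by rewrite /k lerDl.
Qed.

End Solution.

End Uniqueness.

(** * Continuation in time *)

Section Slabs.
Context {R : realType} {n : nat} (alpha nu T c : R) (G : set 'rV[R]_n).
Hypotheses (G_open : open G) (nu0 : 0 < nu) (c0 : 0 <= c)
  (alpha0 : 0 < alpha) (alpha1 : alpha < 1) (T1 : 1 < T).
Hypothesis (G_bounded : bounded_set G).
Variables (w g z : 'rV[R]_n -> R -> R) (q : 'I_n -> 'rV[R]_n -> R -> R).
Variables (w' g' z' : 'rV[R]_n -> R -> R) (q' : 'I_n -> 'rV[R]_n -> R -> R).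
Hypothesis wg : homogeneous_solution alpha nu T c G w g z q.
Hypothesis wg' : homogeneous_solution alpha nu T c G w' g' z' q'.
Hypotheses (w'E : forall x t, w' x t = - w x t) (g'E : forall x t, g' x t = - g x t).
Implicit Types (x y : 'rV[R]_n) (e s t : R) (i j : 'I_n).

(** Let [|g|] be maximal at [(xm, tm)] over the closed cylinder up to time [T'].
    If the maximum were positive, then [tm > tau], and [no_positive_maximum]
    would apply to [w] or to [- w] according to the sign of [g xm tm]. *)
Lemma slab_vanish tau T' : 0 < c -> 1 <= tau ->
  T' <= T -> T' <= (1 + (1 - alpha) / 8) * tau ->
  (forall x t, closure G x -> t <= tau -> w x t = 0) ->
  forall x t, closure G x -> t <= T' -> w x t = 0.
Proof.
move=> cp tau1 TT Tq w0 x t cx tT'.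
have [T'1|T'1] := ltP T' 1.
  by apply: (hs_initial wg) => //; exact: (le_trans tT' (ltW T'1)).
apply: (solution_vanish G_open wg TT) tT' => // {x t cx} x t cx t1 tT'.
have := @compact_EVT_max _ R (fun p : 'rV[R]_n * R => `|g p.1 p.2|)
  (closure G `*` `[1, T']).
case.
- by exists (x, t); split => //=; rewrite in_itv/= t1.
- by apply: compact_setX; [exact: compact_closure|exact: segment_compact].
- exact: (continuous_integral_joint c0 alpha0 T1 wg TT).
move=> [xm tm]; rewrite inE/= => -[cxm]; rewrite in_itv/= => /andP[tm1 tmT'] gmax.
have {}gmax y s : closure G y -> 1 <= s -> s <= T' -> `|g y s| <= `|g xm tm|.
  move=> cy s1 sT; apply: (gmax (y, s)); rewrite inE; split => //=.
  by rewrite in_itv/= s1.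
apply/eqP; rewrite -normr_eq0 eq_le normr_ge0 andbT.
apply: (le_trans (gmax _ _ cx t1 tT')).
have tmT := le_trans tmT' TT.
have tmq := le_trans tmT' Tq.
have [tmtau|tautm] := leP tm tau.
  rewrite (integral_vanish wg (tau := tau))// ?normr0//.
  by move=> s; rewrite in_itv/= => /andP[_]; exact: w0.
rewrite leNgt; apply/negP => gm0.
have [gp|gn|g0] := ltgtP 0 (g xm tm).
- apply: (@no_positive_maximum _ _ _ _ _ _ _ G_open nu0 c0 alpha0 alpha1 T1
    _ _ _ _ wg tau xm tm) => //.
    by move=> y cy s; rewrite in_itv/= => /andP[_]; exact: w0.
  move=> y s cy s1 st; rewrite -[leRHS]gtr0_norm//; apply: gmax => //.
  exact: le_trans tmT'.
- apply: (@no_positive_maximum _ _ _ _ _ _ _ G_open nu0 c0 alpha0 alpha1 T1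
    _ _ _ _ wg' tau xm tm) => //.
  + by move=> y cy s; rewrite in_itv/= => /andP[_ st]; rewrite w'E w0// oppr0.
  + move=> y s cy s1 st; rewrite !g'E normrN -[leRHS]ltr0_norm//.
    by apply: gmax => //; exact: le_trans tmT'.
  + by rewrite g'E oppr_gt0.
- by move: gm0; rewrite -g0 normr0 ltxx.
Qed.

(** For [c = 0] the integral [g] vanishes identically. Otherwise the slabs of
    [slab_vanish] have length at least [(1 - alpha) / 8], because they start at
    times [tau >= 1], and finitely many of them reach [T]. *)
Lemma homogeneous_solution_eq0 x t : closure G x -> t <= T -> w x t = 0.
Proof.
move: c0; rewrite le_eqVlt => /predU1P[cE|cp].
  apply: (solution_vanish G_open wg (lexx T)) => y s cy s1 sT.
  by rewrite (hs_integral wg)// -cE mul0r.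
pose d := (1 - alpha) / 8.
have d0 : 0 < d by rewrite divr_gt0// subr_gt0.
have step (N : nat) : forall y s, closure G y ->
    s <= Num.min T (1 + N%:R * d) -> w y s = 0.
  elim: N => [|N IH] y s cy sN.
    apply: (hs_initial wg) => //; apply: (le_trans sN).
    by rewrite mul0r addr0 ge_min lexx orbT.
  pose tau := Num.max 1 (Num.min T (1 + N%:R * d)).
  have tau1 : 1 <= tau by rewrite /tau le_max lexx.
  apply: (@slab_vanish tau (Num.min T (1 + N.+1%:R * d))) => //.
  - by rewrite ge_min lexx.
  - have tauE : tau = Num.min T (1 + N%:R * d).
      by apply/max_idPr; rewrite le_min (ltW T1)/= lerDl mulr_ge0// ltW.
    have dtau : tau + d <= (1 + d) * tau.
      by rewrite mulrDl mul1r lerD2l ler_peMr// ltW.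
    apply: (le_trans _ dtau); rewrite tauE.
    rewrite -natr1 mulrDl mul1r addrA.
    have [TN|TN] := leP T (1 + N%:R * d); first by rewrite ge_min lerDl ltW.
    by rewrite ge_min lexx orbT.
  - move=> y' s' cy'; rewrite /tau le_max => /orP[|]; last exact: IH.
    exact: (hs_initial wg).
move=> cx tT; pose N := Num.bound ((T - 1) / d).
apply: (step N) => //; rewrite le_min tT/= (le_trans tT)//.
rewrite -lerBlDl -ler_pdivrMr//; apply: ltW.
by rewrite archi_boundP// divr_ge0 ?subr_ge0// ltW.
Qed.

End Slabs.

(** * The difference of two solutions *)

Section UniformContinuity.
Context {R : realType} {n : nat}.
Implicit Types (x y : 'rV[R]_n) (e s t a b : R).

(** Compactness of [[a, b]] makes the continuity in space at [x] uniform in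
    time. *)
Lemma within_equicontinuous (A : set 'rV[R]_n) a b (f : 'rV[R]_n -> R -> R) x :
  {within A `*` `[a, b], continuous (fun p : 'rV[R]_n * R => f p.1 p.2)} -> A x ->
  forall e, 0 < e -> \forall y \near x, A y ->
    forall t, a <= t -> t <= b -> `|f y t - f x t| <= e.
Proof.
move=> /subspace_continuousP cf Ax e e0.
have e2 : 0 < e / 2 by rewrite divr_gt0.
have := (compact_near_coveringP _).1 (segment_compact (a := a) (b := b)).
move=> /near_covering_withinP /(_ _ (nbhs x)
  (fun y t => A y -> `|f y t - f x t| <= e)).
have H t : `[a, b]%classic t -> \forall t' \near t & y \near x,
    `[a, b]%classic t' -> A y -> `|f y t' - f x t'| <= e.
  move=> tab.
  have := cf (x, t) (conj Ax tab).
  move=> /cvgrPdist_le /(_ _ e2); rewrite near_withinE => -[[P Q] /= [xP tQ] PQ].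
  exists (Q, P) => //= -[t' y] /= [Qt' Py] t'ab Ay.
  have H1 := PQ (y, t') (conj Py Qt') (conj Ay t'ab).
  have H2 := PQ (x, t') (conj (nbhs_singleton xP) Qt') (conj Ax t'ab).
  rewrite /= in H1 H2.
  rewrite -(subrKA (f x t)) (le_trans (ler_normD _ _))// [leRHS](splitr e).
  by rewrite lerD// distrC.
move=> /(_ _ H) H1.
apply: (@filterS _ (nbhs x) _ _ _ _ H1) => y yP Ay t ta tb.
by apply: yP => //=; rewrite in_itv/= ta.
Qed.

Lemma within_bounded (A : set ('rV[R]_n * R)) (f : 'rV[R]_n * R -> R) : compact A ->
  {within A, continuous f} -> exists C, forall p, A p -> `|f p| <= C.
Proof.
move=> cA cf; have [[p0 Ap0]|A0] := pselect (A !=set0); last first.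
  by exists 0 => p Ap; case: A0; exists p.
have cn : {within A, continuous (fun p => `|f p|)}.
  by move=> p; apply: cvg_norm; exact: cf.
have [p _ pmax] := compact_EVT_max (ex_intro _ p0 Ap0) cA cn.
by exists `|f p| => p' Ap'; apply: pmax; rewrite inE.
Qed.

End UniformContinuity.

Lemma norm_subrB_le {R : realType} (a b c d : R) :
  `|a - b - (c - d)| <= `|a - c| + `|b - d|.
Proof.
have -> : a - b - (c - d) = (a - c) - (b - d) by ring.
exact: ler_normB.
Qed.

Section Clamp.
Context {R : realType} (T : R).
Hypothesis T1 : 1 < T.
Implicit Types s t : R.

(** The projection of the real line onto [[1, T]], used to extend functions of
    time by constants. *)
Definition clamp t : R := Num.max 1 (Num.min t T).

Lemma clamp_itv t : 1 <= clamp t <= T.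
Proof. by rewrite /clamp le_max lexx/= ge_max (ltW T1)/= ge_min lexx orbT. Qed.

Lemma clampE t : 1 <= t -> t <= T -> clamp t = t.
Proof. by move=> t1 tT; rewrite /clamp (min_idPl tT) (max_idPr t1). Qed.

Lemma clamp_le1 t : t <= 1 -> clamp t = 1.
Proof.
move=> t1; rewrite /clamp (min_idPl (le_trans t1 (ltW T1))).
exact/max_idPl.
Qed.

Lemma clamp_continuous : continuous clamp.
Proof.
move=> t; apply: (@continuous_max R R (cst 1) (id \min cst T)).
  exact: cst_continuous.
by apply: continuous_min; [exact: cvg_id|exact: cst_continuous].
Qed.

End Clamp.

Section Difference.
Context {R : realType} {n : nat} (alpha nu T : R) (G : set 'rV[R]_n)
  (F : 'rV[R]_n -> R -> R) (phi : 'rV[R]_n -> R) (psi : 'rV[R]_n -> R -> R).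
Hypotheses (alpha0 : 0 < alpha) (T1 : 1 < T) (G_open : open G)
  (G_bounded : bounded_set G).
Implicit Types (x y : 'rV[R]_n) (e s t : R) (i j : 'I_n).

Section OneSolution.
Variable u : 'rV[R]_n -> R -> R.
Hypothesis u_solution : classical_solution alpha nu T G F phi psi u.

Let uc x t := u x (clamp T t).

Lemma clamped_continuous x : closure G x -> continuous (uc x).
Proof.
move=> cx t; have /subspace_continuousP cu := sol_continuous u_solution.
have At s : Omega_bar G T (x, clamp T s).
  by split => //=; rewrite in_itv/= clamp_itv.
have H := cu (x, clamp T t) (At t).
have H2 : (fun s => (x, clamp T s)) @ nbhs t -->
      within (Omega_bar G T) (nbhs (x, clamp T t)).
  move=> P /= PA.
  have H3 : (fun s => (x, clamp T s)) @ nbhs t --> nbhs (x, clamp T t).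
    have cc : cst x @ nbhs t --> x by exact: cvg_cst.
    exact: (cvg_pair cc (@clamp_continuous R T t)).
  have := H3 _ PA; rewrite /= !nbhs_simpl/=.
  by apply: (@filterS _ (nbhs t)) => s; apply; exact: At.
exact: (cvg_comp _ _ H2 H).
Qed.

Lemma clamped_equicontinuous x : closure G x -> forall e, 0 < e ->
  \forall y \near x, closure G y -> forall t, `|uc y t - uc x t| <= e.
Proof.
move=> cx e e0.
have := within_equicontinuous (sol_continuous u_solution) cx e0.
apply: (@filterS _ (nbhs x)) => y H cy t; have /andP[? ?] := clamp_itv T1 t.
exact: H.
Qed.

Lemma clamped_bounded :
  exists C, forall x, closure G x -> forall t, `|uc x t| <= C.
Proof.
have cA : compact (Omega_bar G T).
  by apply: compact_setX; [exact: compact_closure|exact: segment_compact].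
have [C uC] := within_bounded cA (sol_continuous u_solution).
exists C => x cx t; apply: (uC (x, clamp T t)).
by split => //=; rewrite in_itv/= clamp_itv.
Qed.

(** Up to time [T] the integral only involves times in [[1, T]], where clamping
    changes nothing. *)
Lemma hadamard_clamped x t : t <= T ->
  hadamard_int alpha (u x) t = (Gamma alpha)^-1 * hadamard alpha (uc x) t.
Proof.
move=> tT; rewrite hadamard_intE; congr (_ * _); apply: eq_hadamard => s.
by rewrite in_itv/= => /andP[s1 st]; rewrite /uc clampE// (le_trans st).
Qed.

Lemma is_derive_in_hadamard x t : G x -> 1 < t -> t <= T ->
  is_derive_in `[1, T] (hadamard_int alpha (u x)) t
    (hadamard_D1 alpha T (u x) t / t).
Proof.
move=> Gx t1 tT; have t0 : t != 0 by rewrite gt_eqF// (lt_trans ltr01).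
rewrite /hadamard_D1 mulrAC divff// mul1r.
by apply: (sol_hadamard u_solution); split => //=; rewrite in_itv/= t1.
Qed.

Lemma is_derive_in_solution x t : G x -> 1 < t -> t <= T ->
  is_derive_in `[1, T] (uc x) t
    (nu * laplacian (fun y => hadamard_D1 alpha T (u y) t) x + F x t).
Proof.
move=> Gx t1 tT.
have Ot : Omega G T (x, t) by split => //=; rewrite in_itv/= t1.
apply: (@eq_is_derive_in _ _ (u x)).
- by rewrite /= in_itv/= ltW.
- by move=> s; rewrite inE/= in_itv/= => /andP[s1 sT]; rewrite /uc clampE.
- by rewrite -(sol_equation u_solution Ot); exact: (sol_derivable u_solution Ot).
Qed.

Let zu y t := hadamard_D1 alpha T (u y) t.

Lemma is_derive_D1 i x t : G x -> 1 < t -> t <= T ->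
  is_derive x (unit_vec R i) (zu ^~ t) (partial i (zu ^~ t) x) /\
  is_derive x (unit_vec R i) (partial i (zu ^~ t)) (partial i (partial i (zu ^~ t)) x).
Proof.
move=> Gx t1 tT.
have Ot : Omega G T (x, t) by split => //=; rewrite in_itv/= t1.
have [C1 C2] := sol_C2 u_solution.
split; apply/derivableP.
- exact: ((C1 i).1 x t Ot).
- exact: ((C2 i i).1 x t Ot).
Qed.

Lemma second_partial_equicontinuous x t1 : G x -> 1 < t1 -> forall e, 0 < e ->
  \forall y \near x, forall i t, t1 <= t -> t <= T ->
    `|partial i (partial i (zu ^~ t)) y - partial i (partial i (zu ^~ t)) x| <= e.
Proof.
move=> Gx t11 e e0; apply: (@filter_forall _ _ _ (nbhs x)) => i.
have [_ C2] := sol_C2 u_solution.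
have sub : G `*` `[t1, T] `<=` Omega G T.
  move=> [y s] [/= Gy]; rewrite in_itv/= => /andP[s1 sT].
  by split => //=; rewrite in_itv/= sT (lt_le_trans t11).
have := within_equicontinuous (f := fun y t => partial i (partial i (zu ^~ t)) y)
  (continuous_subspaceW sub (C2 i i).2) Gx e0.
have nG : nbhs x G by exact: open_nbhs_nbhs.
apply: (@filterS2 _ (nbhs x) _ _ _ _ _ nG) => y Gy H t t1t tT.
exact: H.
Qed.

End OneSolution.

Variables u v : 'rV[R]_n -> R -> R.
Hypothesis u_solution : classical_solution alpha nu T G F phi psi u.
Hypothesis v_solution : classical_solution alpha nu T G F phi psi v.

Lemma homogeneous_solutionB :
  homogeneous_solution alpha nu T (Gamma alpha)^-1 G
    (fun x t => u x (clamp T t) - v x (clamp T t))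
    (fun x t => hadamard_int alpha (u x) t - hadamard_int alpha (v x) t)
    (fun x t => hadamard_D1 alpha T (u x) t - hadamard_D1 alpha T (v x) t)
    (fun i x t =>
      partial i (partial i (fun y => hadamard_D1 alpha T (u y) t)) x -
      partial i (partial i (fun y => hadamard_D1 alpha T (v y) t)) x).
Proof.
have [Cu uC] := clamped_bounded u_solution.
have [Cv vC] := clamped_bounded v_solution.
split.
- move=> x cx t; apply: continuousB.
    exact: (clamped_continuous u_solution cx).
  exact: (clamped_continuous v_solution cx).
- move=> x cx e e0; have e2 : 0 < e / 2 by rewrite divr_gt0.
  have H1 := clamped_equicontinuous u_solution cx e2.
  have H2 := clamped_equicontinuous v_solution cx e2.
  apply: (@filterS2 _ (nbhs x) _ _ _ _ _ H1 H2) => y uy vy cy t.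
  apply: (le_trans (norm_subrB_le _ _ _ _)).
  rewrite [leRHS](splitr e).
  by apply: lerD; [exact: uy|exact: vy].
- exists (Cu + Cv) => x cx t; rewrite (le_trans (ler_normB _ _))//.
  by apply: lerD; [exact: uC|exact: vC].
- move=> x cx t t1; rewrite clamp_le1// (sol_initial u_solution)//.
  by rewrite (sol_initial v_solution)// subrr.
- move=> x bx t; have tT : clamp T t \in `[1, T] by rewrite in_itv/= clamp_itv.
  by rewrite (sol_boundary u_solution)// (sol_boundary v_solution)// subrr.
- move=> x t cx t1 tT; rewrite !hadamard_clamped// -mulrBr; congr (_ * _).
  rewrite -(@hadamardB _ _ _ _ _ (Num.max Cu Cv))//.
  + apply: measurable_funTS; apply: continuous_measurable_fun.
    exact: (clamped_continuous u_solution cx).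
  + by move=> s _; rewrite le_max uC.
  + apply: measurable_funTS; apply: continuous_measurable_fun.
    exact: (clamped_continuous v_solution cx).
  + by move=> s _; rewrite le_max vC// orbT.
- move=> x t Gx t1 tT; rewrite mulrBl; apply: is_derive_inB.
    exact: (is_derive_in_hadamard u_solution).
  exact: (is_derive_in_hadamard v_solution).
- move=> x t Gx t1 tT.
  have H := is_derive_inB (is_derive_in_solution u_solution Gx t1 tT)
    (is_derive_in_solution v_solution Gx t1 tT).
  have E (a b d : R) : nu * (a - b) = nu * a + d - (nu * b + d) by ring.
  by rewrite sumrB (E _ _ (F x t)); exact: H.
- move=> i x t e t1 tT e0 Gs.
  pose f (w : 'rV[R]_n -> R -> R) s := hadamard_D1 alpha T (w (x + s *: unit_vec R i)) t.
  pose zz (w : 'rV[R]_n -> R -> R) y := hadamard_D1 alpha T (w y) t.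
  pose f1 w s := partial i (zz w) (x + s *: unit_vec R i).
  pose f2 w s := partial i (partial i (zz w)) (x + s *: unit_vec R i).
  have := @second_difference R (fun s => f u s - f v s) (fun s => f1 u s - f1 v s)
    (fun s => f2 u s - f2 v s) e e0.
  case.
  + move=> s es se; have Gxs := Gs s es se.
    have du := is_derive_line (is_derive_D1 u_solution i Gxs t1 tT).1.
    have dv := is_derive_line (is_derive_D1 v_solution i Gxs t1 tT).1.
    exact: is_deriveB du dv.
  + move=> s es se; have Gxs := Gs s es se.
    have du := is_derive_line (is_derive_D1 u_solution i Gxs t1 tT).2.
    have dv := is_derive_line (is_derive_D1 v_solution i Gxs t1 tT).2.
    exact: is_deriveB du dv.
  move=> s [es se]; rewrite /f scaleNr scale0r addr0 => H.
  by exists s; split.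
- move=> x t1 Gx t11 e e0; have e2 : 0 < e / 2 by rewrite divr_gt0.
  have H1 := second_partial_equicontinuous u_solution Gx t11 e2.
  have H2 := second_partial_equicontinuous v_solution Gx t11 e2.
  apply: (@filterS2 _ (nbhs x) _ _ _ _ _ H1 H2) => y uy vy i t t1t tT.
  apply: (le_trans (norm_subrB_le _ _ _ _)).
  rewrite [leRHS](splitr e).
  by apply: lerD; [exact: uy|exact: vy].
Qed.

End Difference.

Theorem theorem5p5 (R : realType) (n : nat) (n_gt0 : (0 < n)%N)
    (alpha nu T : R) (alpha_gt0 : 0 < alpha) (alpha_lt1 : alpha < 1)
    (nu_gt0 : 0 < nu) (T_gt1 : 1 < T)
    (G : set 'rV[R]_n) (G_domain : domain G) (G_bounded : bounded_set G)
    (G_smooth : smooth_boundary G)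
    (F : 'rV[R]_n -> R -> R) (phi : 'rV[R]_n -> R) (psi : 'rV[R]_n -> R -> R)
    (F_continuous : {within Omega_bar G T, continuous (fun p => F p.1 p.2)})
    (phi_continuous : {within closure G, continuous phi})
    (psi_continuous :
      {within boundary G `*` `[1, T], continuous (fun p => psi p.1 p.2)})
    (u v : 'rV[R]_n -> R -> R)
    (u_solution : classical_solution alpha nu T G F phi psi u)
    (v_solution : classical_solution alpha nu T G F phi psi v) :
  forall x t, Omega_bar G T (x, t) -> u x t = v x t.
Proof.
move=> x t [/= cx]; rewrite in_itv/= => /andP[t1 tT].
have [G_open _ _] := G_domain.
have c0 : 0 <= (Gamma alpha)^-1.
  rewrite invr_ge0; apply: Rintegral_ge0 => s _.
  by rewrite mulr_ge0 ?powR_ge0// expR_ge0.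
(* both orders of subtraction: positive maxima of the second difference are
   negative minima of the first *)
have uv := homogeneous_solutionB alpha_gt0 T_gt1 G_open G_bounded u_solution v_solution.
have vu := homogeneous_solutionB alpha_gt0 T_gt1 G_open G_bounded v_solution u_solution.
apply/eqP; rewrite -subr_eq0; apply/eqP; rewrite -(clampE t1 tT).
apply: (homogeneous_solution_eq0 G_open nu_gt0 c0 alpha_gt0 alpha_lt1 T_gt1
  G_bounded uv vu) => //.
- by move=> y s; rewrite opprB.
- by move=> y s; rewrite opprB.
Qed.
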